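(* For each $N$ let $\mathcal{S}_N\subset\{1,2,\ldots,N\}$ have density $\gtrapprox 1$, that is $|\mathcal{S}_N|\gtrapprox N$. Then for each $\theta\in[0,1]$ and each $\lambda=\lambda_N$ with $\lambda\gtrapprox N^{\frac14+\frac1{10}}$, $$\Big|\Big\{x\in[0,1]:\ \sup_{t}\Big|\frac{1}{N^{1/2}}\sum_{n\in\mathcal{S}_N}e(nx+n^2t+n^3\theta)\Big|\ge \lambda\Big\}\Big|\lessapprox \frac{N}{\lambda^4},$$ where the supremum is over $t\in\mathbb{R}$, and the implicit constants in the conclusion depend only on $\epsilon$ and on the implicit constants in the hypotheses.
   Context: $e(z)=e^{2\pi i z}$; $|E|$ denotes Lebesgue measure for subsets of $[0,1]$ and cardinality for finite sets. $N$ is a positive integer (the main scale parameter). For quantities $A=A_N$, $B=B_N$, $A\lessapprox B$ (equivalently $B\gtrapprox A$) means: for every $\epsilon>0$ there is a constant $C_\epsilon$, independent of $N$, with $A\le C_\epsilon N^\epsilon B$. *)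

(* Defs.v *)
From HB Require Import structures.
From mathcomp Require Import all_boot all_order all_algebra finmap.
From mathcomp Require Import complex.
From mathcomp Require Import all_classical all_reals all_analysis.

Set Implicit Arguments.
Unset Strict Implicit.
Unset Printing Implicit Defensive.

Import Order.TTheory GRing.Theory Num.Theory.

Local Open Scope ring_scope.

(* A_N <= C_eps N^eps B_N for every eps > 0 and every N >= 1. The implicit
   constants eps |-> C_eps are a parameter of the relation, so that a statement
   can say what they may depend on; A ⪅ B is [exists C, lessapprox C A B]. *)
Definition lessapprox (R : realType) (C : R -> R) (A B : nat -> \bar R) : Prop :=
  forall eps : R, 0 < eps ->
    0 < C eps /\
    forall N : nat, (0 < N)%N -> (A N <= (C eps * N%:R `^ eps)%:E * B N)%E.

(* e(x) = exp(2 pi i x) for real x, by Euler's formula. *)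
Definition e (R : realType) (x : R) : R[i] :=
  (cos (2 * pi * x) +i* sin (2 * pi * x))%C.

Definition weyl_sum (R : realType) (N : nat) (A : {fset nat}) (x t theta : R) : R[i] :=
  (N%:R `^ (- 2^-1))%:C%C *
  \sum_(n <- A) e (n%:R * x + n%:R ^+ 2 * t + n%:R ^+ 3 * theta).

(* [sup] is a real supremum: the set is nonempty, and bounded above by
   N^(-1/2) * #|` A |, so this is never the default value of [sup]. *)
Definition maximal_weyl_sum (R : realType) (N : nat) (A : {fset nat})
    (theta x : R) : R :=
  sup (range (fun t : R => ComplexField.Normc.normc (weyl_sum N A x t theta))).

Definition level_set (R : realType) (N : nat) (A : {fset nat})
    (theta lambda : R) : set R :=
  [set x : R | 0 <= x <= 1 /\ lambda <= maximal_weyl_sum N A theta x].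

(* Main.v *)
Require Import Defs.
From HB Require Import structures.
From mathcomp Require Import all_boot all_order all_algebra finmap.
From mathcomp Require Import complex.
From mathcomp Require Import all_classical all_reals all_analysis.
From mathcomp Require Import ring lra zify.

Set Implicit Arguments.
Unset Strict Implicit.
Unset Printing Implicit Defensive.

Import Order.TTheory GRing.Theory Num.Theory.
Import numFieldNormedType.Exports.

Local Open Scope ring_scope.
Local Open Scope complex_scope.

(* Choose one point x_r, with a good t_r, in each cell [k/N, (k+1)/N] that meets
   the level set; R is their number. By duality, with M = lambda^2 / 4 and K the
   quadratic Weyl sum over all n <= N,
     M (sum_r v_r)^2 <= sum_(r,s) v_r v_s |K (x_r - x_s, t_r - t_s)|   (v >= 0).
   So if f is |K| restricted to the pairs (edges) with |K| >= M/2, taking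
   v = f (r, -) and summing over r gives, for Y = sum f,
     sum_(r,s,u) f(r,s) f(s,u) f(u,r) >= M Y^2 / (2 R),   Y >= M R^2 / 2.
   By Weyl differencing, on an edge x_r - x_s and t_r - t_s are close to fractions
   with a common denominator q <~ (N / |K|)^2, and the t-fraction is reduced. On a
   triangle the three t-fractions add up to 0 exactly, so the denominators are
   dbc, dac, dab. Counting the third vertices of triangles on a given edge, with
   weights whose product over the three edges is controlled by
   |K_1| |K_2| |K_3|, yields sum f f f <~ N^2 Y, and hence R <~ N^2 / lambda^4.
   The hypothesis lambda >~ N^(7/20) enters when the x-fractions of a triangle do
   not add up to 0. *)

(** * The exponential e *)

(** Why triangles: on a single edge the denominator and the fraction are free, and counting
    neighbours pays for all of them. Once an edge with denominator q1 = dbc is fixed, d, b and c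
    divide q1, and the new parameter of a third vertex is a, with weight 1 / (d a^2) against O (d a)
    positions. Only logarithms and numbers of divisors are lost. The product |K_1| |K_2| |K_3| is
    distributed over the three edges by a mean inequality, so only the product of the three weights
    has to be controlled. Origin of 7/20: up to factors N^eps, denominators are at most P = N^2 /
    lambda^4 <= N^(3/5). The hypothesis enters through P^3 < N^2, which forces an integer of size O
    (P^3 / N^2) to vanish and gives the exact relation between the t-fractions, and through P^5 <~
    N^3, which pays for the defect of the x-fractions. The second is the binding one: P = N^(3/5)
    corresponds to lambda = N^(7/20). *)

Notation normc := ComplexField.Normc.normc.

Lemma normc_ge0 (R : realType) (z : R[i]) : 0 <= normc z.
Proof. by case: z => a b; rewrite /normc sqrtr_ge0. Qed.

Lemma normr_normc (R : realType) (z : R[i]) : `|z| = (normc z)%:C.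
Proof. by []. Qed.

Lemma normcD_le (R : realType) (z w : R[i]) : normc (z + w) <= normc z + normc w.
Proof. by rewrite -lecR rmorphD /= -!normr_normc ler_normD. Qed.

Lemma normcN_eq (R : realType) (z : R[i]) : normc (- z) = normc z.
Proof. by case: z => a b; rewrite /normc /= !sqrrN. Qed.

Lemma normcJ_eq (R : realType) (z : R[i]) : normc z^* = normc z.
Proof. by case: z => a b; rewrite /normc /= sqrrN. Qed.

Lemma normc_sum (R : realType) (I : Type) (r : seq I) (P : pred I) (F : I -> R[i]) :
  normc (\sum_(i <- r | P i) F i) <= \sum_(i <- r | P i) normc (F i).
Proof.
elim/big_rec2 : _ => [|i y z _ h]; first by rewrite ComplexField.Normc.normc0.
by rewrite (le_trans (normcD_le _ _))// lerD2l.
Qed.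

Lemma normc_real (R : realType) (a : R) : normc a%:C = `|a|.
Proof. by rewrite /normc /= expr0n addr0 sqrtr_sqr. Qed.

Lemma normc_ge_absRe (R : realType) (z : R[i]) : `|complex.Re z| <= normc z.
Proof. by rewrite -lecR -normr_normc normc_ge_Re. Qed.

Lemma normc_sqr (R : realType) (z : R[i]) : (normc z ^+ 2)%:C = z * (z^*)%C.
Proof. by rewrite rmorphXn /= -normr_normc sqr_normc. Qed.

Lemma conjcM (R : realType) (z w : R[i]) : ((z * w)^*)%C = ((z^*)%C * (w^*)%C)%R.
Proof.
case: z w => a b [c d]; apply/eqP; rewrite eq_complex /=.
by apply/andP; split; apply/eqP; ring.
Qed.

Lemma conjc_sum (R : realType) (I : Type) (r : seq I) (P : pred I) (F : I -> R[i]) :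
  ((\sum_(i <- r | P i) F i)^*)%C = \sum_(i <- r | P i) (F i)^*%C.
Proof.
elim/big_rec2 : _ => [|i y z _ <-]; first by apply/eqP; rewrite eq_complex /= oppr0 !eqxx.
by case: (F i) z => a b [c d]; apply/eqP; rewrite eq_complex /= opprD !eqxx.
Qed.

Lemma eD (R : realType) (x y : R) : e (x + y) = e x * e y.
Proof.
rewrite /e mulrDr cosD sinD; apply/eqP; rewrite eq_complex /=.
by apply/andP; split; apply/eqP; ring.
Qed.

Lemma e0 (R : realType) : e (0 : R) = 1.
Proof. by rewrite /e mulr0 cos0 sin0. Qed.

Lemma eN (R : realType) (x : R) : e (- x) = (e x)^*.
Proof. by rewrite /e mulrN cosN sinN. Qed.

Lemma normc_e (R : realType) (x : R) : normc (e x) = 1.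
Proof. by rewrite /e /normc cos2Dsin2 sqrtr1. Qed.

Lemma e_nat (R : realType) (n : nat) : e (n%:R : R) = 1.
Proof.
elim: n => [|n IH]; first exact: e0.
by rewrite -natr1 eD IH mul1r /e mulr1 mulrC mulr_natr cos2pi sin2pi.
Qed.

Lemma e_int (R : realType) (m : int) : e (m%:~R : R) = 1.
Proof.
case: m => n; first exact: e_nat.
by rewrite NegzE mulrNz eN -[X in e X]/(n.+1%:R) e_nat; apply/eqP; rewrite eq_complex /= oppr0 !eqxx.
Qed.

Lemma eDint (R : realType) (x : R) (m : int) : e (x + m%:~R) = e x.
Proof. by rewrite eD e_int mulr1. Qed.

Lemma lipschitz_of_derive1 (R : realType) (f df : R -> R) :
  (forall x : R, is_derive x 1 f (df x)) -> (forall x, `|df x| <= 1) ->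
  forall x y, `|f x - f y| <= `|x - y|.
Proof.
move=> fd bd x y.
wlog xy : x y / y <= x.
  move=> H; case: (leP y x) => [|/ltW] h; first exact: H.
  by rewrite distrC [leRHS]distrC H.
have [c _ ->] := @MVT_segment R f df y x xy (fun z _ => fd z) (fun z => ltac:(
   apply: continuous_subspaceT => w; apply: differentiable_continuous;
   by apply/derivable1_diffP; have := fd w)).
by rewrite normrM ler_piMl.
Qed.

(** Real and imaginary part each have Lipschitz constant 2 pi, and pi < 4 turns the total 4 pi into
    16. *)
Lemma e_lip (R : realType) (x y : R) : normc (e x - e y) <= 16 * `|x - y|.
Proof.
have cosl : `|cos (2 * pi * x) - cos (2 * pi * y)| <= `|2 * pi * x - 2 * pi * y|.
  apply: (lipschitz_of_derive1 (@is_derive_cos R)) => z.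
  by rewrite normrN sin_max.
have sinl : `|sin (2 * pi * x) - sin (2 * pi * y)| <= `|2 * pi * x - 2 * pi * y|.
  apply: (lipschitz_of_derive1 (@is_derive_sin R)) => z.
  exact: cos_max.
rewrite (_ : e x - e y = (cos (2 * pi * x) - cos (2 * pi * y))%:C + 'i * (sin (2 * pi * x) - sin (2 * pi * y))%:C); last first.
  by apply/eqP; rewrite eq_complex /=; apply/andP; split; apply/eqP; ring.
rewrite (le_trans (normcD_le _ _))// ComplexField.Normc.normcM !normc_real.
rewrite (_ : normc 'i = 1); last by rewrite /normc /= expr0n expr1n add0r sqrtr1.
have dE : `|2 * pi * x - 2 * pi * y| = 2 * pi * `|x - y|.
  by rewrite -mulrBr normrM ger0_norm// mulr_ge0// pi_ge0.
rewrite dE in cosl sinl.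
have := pihalf_lt2 R => pi2.
have : pi * `|x - y| <= 4 * `|x - y| by rewrite ler_wpM2r// ltW//; lra.
by lra.
Qed.

Lemma e_lip_mod1 (R : realType) (x y : R) (m : int) :
  normc (e x - e y) <= 16 * `|x - y - m%:~R|.
Proof. by rewrite -(eDint y m) (le_trans (e_lip _ _))// opprD addrA. Qed.

(* Doubling d at most doubles |e d - 1|; once 1/4 <= |d| <= 1/2, the cosine is
   nonpositive and |e d - 1| >= 1. *)
Lemma e_sub1_small (R : realType) (k : nat) (d : R) :
  2 ^- k.+2 <= `|d| -> `|d| <= 2^-1 :> R -> 2 * `|d| <= normc (e d - 1).
Proof.
elim: k d => [|k IH] d d1 d2.
  have c0 : cos (2 * pi * d) <= 0.
    rewrite -cos_norm normrM (@ger0_norm _ (2 * pi)) ?mulr_ge0 ?pi_ge0//.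
    set y := 2 * pi * `|d|.
    have -> : y = (y - pi) + pi by ring.
    rewrite cosDpi oppr_le0; apply: cos_ge0_pihalf.
    have := pi_gt0 R; rewrite /y => pi0.
    have e4 : 2 ^- 2 = 4^-1 :> R by rewrite expr2 -natrM.
    rewrite e4 in d1.
    have : pi * 4^-1 <= pi * `|d| by rewrite ler_pM2l.
    have : pi * `|d| <= pi * 2^-1 by rewrite ler_pM2l.
    by move=> *; apply/andP; split; lra.
  apply: le_trans (normc_ge_absRe _).
  have -> : complex.Re (e d - 1) = cos (2 * pi * d) - 1 by [].
  move: (cos _) c0 => cc c0.
  have h : cc - 1 <= 0 by lra.
  rewrite (ler0_norm h). lra.
have [|d3] := leP (2 ^- k.+2) `|d|; first by move=> d3; apply: IH.
have n2 : normc (e (2 * d) - 1) <= 2 * normc (e d - 1).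
  have -> : e (2 * d) - 1 = (e d - 1) * (e d + 1).
    by rewrite mulr_natl mulr2n eD; ring.
  rewrite ComplexField.Normc.normcM mulrC ler_wpM2r ?normc_ge0//.
  by rewrite (le_trans (normcD_le _ _))// normc_e ComplexField.Normc.normc1.
have h : 2 ^- k.+2 <= (4^-1 : R).
  rewrite -[leRHS]invrK lef_pV2 ?posrE ?exprn_gt0// ?invr_gt0// invrK.
  rewrite !exprS; have : 1 <= 2 ^+ k :> R by apply: exprn_ege1; lra.
  by move=> ?; lra.
have : 2 * `|2 * d| <= normc (e (2 * d) - 1).
  apply: IH; rewrite normrM ger0_norm//; last by lra.
  move: d1; rewrite [in X in X -> _](exprS _ k.+2) invfM => d1; lra.
rewrite normrM (@ger0_norm _ 2)//; lra.
Qed.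

Lemma e_sub1_lower (R : realType) (d : R) :
  `|d| <= 2^-1 :> R -> 2 * `|d| <= normc (e d - 1).
Proof.
move=> d2; have [->|d0] := eqVneq d 0; first by rewrite normr0 mulr0 normc_ge0.
have d1 : 0 < `|d| by rewrite normr_gt0.
have [k hk] : exists k : nat, 2 ^- k.+2 <= `|d|.
  pose k := (Num.truncn (`|d|^-1)).+1.
  exists k; rewrite invf_ple ?posrE ?exprn_gt0//.
  apply: (@le_trans _ _ k%:R); first by rewrite ltW// /k truncnS_gt// invr_ge0 ltW.
  by rewrite -natrX ler_nat (leq_trans _ (ltnW (ltn_expl _ _)))//; lia.
exact: e_sub1_small hk d2.
Qed.

Lemma nearest_int (R : realType) (x : R) :
  exists m : int, `|x - m%:~R| <= 2^-1 :> R /\ forall m' : int, `|x - m%:~R| <= `|x - m'%:~R|.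
Proof.
pose m : int := Num.floor (x + 2^-1).
have /andP[m1 m2] : m%:~R <= x + 2^-1 < (m + 1)%:~R.
  exact: floor_itv.
rewrite intrD in m2.
have h : `|x - m%:~R| <= 2^-1 by rewrite ler_norml; apply/andP; split; lra.
exists m; split=> // m'.
have [->//|/eqP mm] := eqVneq m' m.
have : (m' <= m - 1) || (m + 1 <= m') by lia.
case/orP; rewrite -(ler_int R) ?rmorphB ?rmorphD /= => k.
  by rewrite (le_trans h)// ler_normr; apply/orP; left; move: m1 => *; lra.
by rewrite (le_trans h)// ler_normr; apply/orP; right; lra.
Qed.

Lemma e_sub1_ge (R : realType) (c d : R) :
  (forall m : int, c <= `|d - m%:~R|) -> 2 * c <= normc (e d - 1).
Proof.
move=> h; have [m [m1 _]] := nearest_int d.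
rewrite -(eDint d (- m)) mulrNz.
by apply: le_trans (e_sub1_lower m1); rewrite ler_pM2l.
Qed.

(** * Summation by parts and Weyl differencing *)

Lemma sum_e_increments (R : realType) (phi : nat -> R) (n : nat) :
  (forall l, (l <= n)%N -> e (phi l.+1 - phi l) - 1 != 0) ->
  let g l := (e (phi l.+1 - phi l) - 1)^-1 in
  \sum_(l < n) e (phi l) =
  e (phi n) * g n - e (phi 0%N) * g 0%N -
  \sum_(l < n) e (phi l.+1) * (g l.+1 - g l).
Proof.
move=> h g; elim: n h => [|n IH] h; first by rewrite !big_ord0 !subrr.
rewrite !big_ord_recr /= IH; last by move=> l ln; apply: h; exact: leqW.
have hn := h n (leqnSn n).
have E : e (phi n) = e (phi n.+1) * g n - e (phi n) * g n.
  rewrite -mulrBl -[X in e X - _](subrK (phi n)) eD -[X in _ - X]mul1r -mulrBl.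
  by rewrite mulrAC divff// mul1r.
rewrite {2}E; ring.
Qed.

(* Summation by parts: e (phi l) is the difference of consecutive terms divided
   by e (increment) - 1, a denominator that varies slowly and stays away from 0. *)
Lemma kusmin_landau (R : realType) (phi : nat -> R) (n : nat) (c gam : R) :
  0 < c -> 0 <= gam -> n%:R * gam <= c ->
  (forall l (m : int), (l <= n)%N -> c <= `|phi l.+1 - phi l - m%:~R|) ->
  (forall l, exists m : int,
     `|(phi l.+2 - phi l.+1) - (phi l.+1 - phi l) - m%:~R| <= gam) ->
  normc (\sum_(l < n) e (phi l)) <= 5 / c.
Proof.
move=> c0 gam0 nc h1 h2.
have lo l : (l <= n)%N -> 2 * c <= normc (e (phi l.+1 - phi l) - 1).
  by move=> ln; apply: e_sub1_ge => m; exact: h1.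
have nz l : (l <= n)%N -> e (phi l.+1 - phi l) - 1 != 0.
  move=> /lo; apply: contraTneq => ->.
  by rewrite ComplexField.Normc.normc0 -ltNge mulr_gt0.
have inv l : (l <= n)%N -> normc (e (phi l.+1 - phi l) - 1)^-1 <= (2 * c)^-1.
  move=> ln; rewrite ComplexField.Normc.normcV lef_pV2 ?posrE ?mulr_gt0//.
    exact: lo.
  by rewrite (lt_le_trans _ (lo _ ln))// mulr_gt0.
rewrite (sum_e_increments nz).
apply: (le_trans (normcD_le _ _)).
(* The two boundary terms give 1/c. Each of the n increments of [g] is at most 16 gam / (2c)^2, and
   n gam <= c bounds their sum by 4/c. *)
apply: (@le_trans _ _ ((2 * c)^-1 + (2 * c)^-1 + n%:R * (16 * gam * (2 * c)^-1 ^+ 2))); last first.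
  have cV : c * c^-1 = 1 by rewrite divff// gt_eqF.
  have cVp : 0 < c^-1 by rewrite invr_gt0.
  have -> : n%:R * (16 * gam * (2 * c)^-1 ^+ 2) = 4 * (n%:R * gam) * c^-1 * c^-1.
    by rewrite invfM; field; rewrite gt_eqF.
  have : 4 * (n%:R * gam) * c^-1 * c^-1 <= 4 * c * c^-1 * c^-1.
    by rewrite !ler_wpM2r ?ler_wpM2l// ltW.
  rewrite invfM -(mulrA 4 c) cV mulr1; lra.
apply: lerD.
  apply: (le_trans (normcD_le _ _)); rewrite normcN_eq.
  by apply: lerD; rewrite ComplexField.Normc.normcM normc_e mul1r inv.
rewrite normcN_eq; apply: (le_trans (normc_sum _ _ _)).
apply: (@le_trans _ _ (\sum_(l < n) (16 * gam * (2 * c)^-1 ^+ 2))); last first.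
  by rewrite sumr_const card_ord -[leLHS]mulr_natl.
apply: ler_sum => l _; rewrite ComplexField.Normc.normcM normc_e mul1r.
have nz0 := nz l (ltnW (ltn_ord l)); have nz1 := nz l.+1 (ltn_ord l).
set a := e _ - 1 in nz0 *; set b := e _ - 1 in nz1 *.
have -> : b^-1 - a^-1 = (a - b) * (b^-1 * a^-1).
  by rewrite mulrBl mulrCA divff// mulr1 mulrA divff// mul1r.
rewrite !ComplexField.Normc.normcM expr2.
apply: ler_pM; rewrite ?normc_ge0 ?mulr_ge0 ?normc_ge0//; last first.
  by apply: ler_pM; rewrite ?normc_ge0//; apply: inv => //; exact: ltnW.
have [m hm] := h2 l.
have -> : a - b = - (e (phi l.+2 - phi l.+1) - e (phi l.+1 - phi l)).
  by rewrite /a /b; ring.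
rewrite normcN_eq (le_trans (e_lip_mod1 _ _ m))//.
by rewrite ler_pM2l.
Qed.

(** Multiplied by [e tau - 1] the sum telescopes to two terms of modulus 1, while the factor has
    modulus at least 2c. *)
Lemma geometric_sum_e (R : realType) (tau c : R) (n : nat) : 0 < c ->
  (forall m : int, c <= `|tau - m%:~R|) ->
  normc (\sum_(l < n) e (l.+1%:R * tau)) <= c^-1.
Proof.
move=> c0 h; have lo := e_sub1_ge h.
have nz : e tau - 1 != 0.
  apply: contraTneq lo => ->.
  by rewrite ComplexField.Normc.normc0 -ltNge mulr_gt0.
have E : (\sum_(l < n) e (l.+1%:R * tau)) * (e tau - 1) = e (n.+1%:R * tau) - e tau.
  elim: n => [|n IH]; first by rewrite big_ord0 mul0r mul1r subrr.
  rewrite big_ord_recr /= mulrDl IH mulrBr mulr1 -eD.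
  by rewrite -[X in e (_ + X)]mul1r -mulrDl natr1; ring.
have := congr1 (@ComplexField.Normc.normc R) E; rewrite ComplexField.Normc.normcM => E2.
have : normc (\sum_(l < n) e (l.+1%:R * tau)) * (2 * c) <= 2.
  apply: (@le_trans _ _ (normc (\sum_(l < n) e (l.+1%:R * tau)) * normc (e tau - 1))).
    by rewrite ler_wpM2l ?normc_ge0.
  by rewrite E2 (le_trans (normcD_le _ _))// normcN_eq !normc_e.
by rewrite mulrCA mulrC -ler_pdivlMr// divff// => H; rewrite -[leRHS]mul1r ler_pdivlMr.
Qed.

(** Expanding the square, the diagonal gives N, and the shifts h and -h give conjugate sums, so the
    rest is twice a real part. The modulus stays outside the sum over h because the information on x
    will come from cancellation in h. *)
Lemma weyl_differencing (R : realType) (z : nat -> R[i]) (N : nat) :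
  (forall i, normc (z i) = 1) ->
  normc (\sum_(i < N) z i) ^+ 2 <=
  N%:R + 2 * normc (\sum_(1 <= h < N) \sum_(i < N - h) z (i + h)%N * ((z i)^*)%C).
Proof.
move=> z1; set T := \sum_(1 <= h < N) _.
have E : (\sum_(i < N) z i) * ((\sum_(i < N) z i)^*)%C = N%:R + (T + (T^*)%C).
  rewrite /T; elim: N {T} => [|N IH].
    by rewrite big_ord0 mul0r big_geq// !add0r; apply/eqP; rewrite eq_complex /= oppr0 !eqxx.
  rewrite big_ord_recr /= rmorphD /= mulrDl !mulrDr IH.
  (* Passing from N to N + 1 adds exactly the pairs formed by N and some i < N, one for each shift h
     = N - i. *)
  have -> : \sum_(1 <= h < N.+1) \sum_(i < N.+1 - h) z (i + h)%N * ((z i)^*)%C =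
     \sum_(1 <= h < N) \sum_(i < N - h) z (i + h)%N * ((z i)^*)%C + z N * ((\sum_(i < N) z i)^*)%C.
    transitivity (\sum_(1 <= h < N.+1) \sum_(i < N - h) z (i + h)%N * ((z i)^*)%C +
                  \sum_(1 <= h < N.+1) z N * ((z (N - h)%N)^*)%C).
      rewrite -big_split /=; apply: eq_big_nat => h /andP[h1 hN].
      by rewrite subSn// big_ord_recr /= subnK.
    congr (_ + _).
      case: N {IH} => [|N]; first by rewrite !big_geq.
      by rewrite big_nat_recr//= subnn big_ord0 addr0.
    rewrite -mulr_sumr rmorph_sum /= big_nat_rev big_add1 /= big_mkord.
    congr (_ * _); apply: eq_bigr => i _.
    by rewrite add1n subSS subSS subnA// ?subnn// 1?ltnW.
  have zN : z N * ((z N)^*)%C = 1 by rewrite -normc_sqr z1 expr1n.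
  rewrite zN -natr1 !rmorphD /= !rmorphM /= conjcK.
  by ring.
have := congr1 (@complex.Re R) E; rewrite -normc_sqr /= => ->.
have -> : complex.Re (N%:R + (T + (T^*)%C) : R[i]) = N%:R + 2 * complex.Re T.
  have -> : (N%:R : R[i]) = (N%:R)%:C by rewrite rmorph_nat.
  by case: T {E} => a b /=; ring.
rewrite lerD2l ler_pM2l//; apply: le_trans (normc_ge_absRe _); exact: ler_norm.
Qed.

(** Stands for the logarithm. Bounds for [harm] and for the number of divisors are merged into one
    parameter [ell], which becomes a power N^del only at the end, by [log_factors]. *)
Definition harm (R : realType) (n : nat) : R := \sum_(i < n) i.+1%:R^-1.

Lemma harm_ge0 (R : realType) n : 0 <= harm R n.
Proof. by apply: sumr_ge0 => i _; rewrite invr_ge0. Qed.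

Lemma le_harm (R : realType) m n : (m <= n)%N -> harm R m <= harm R n.
Proof.
move=> mn; rewrite /harm (big_ord_widen n (fun i => (i.+1%:R : R)^-1) mn).
by rewrite [leRHS](bigID (fun i : 'I_n => (i < m)%N)) /= lerDl sumr_ge0// => i _; rewrite invr_ge0.
Qed.

(** Pigeonhole for the fractional parts of k tau, 0 <= k <= Q, in Q boxes, then reduction to lowest
    terms. Coprimality serves twice: h alpha runs through all residues modulo q, and the
    denominators of a triangle get their special shape. *)
Lemma dirichlet_approximation (R : realType) (tau : R) (Q : nat) : (0 < Q)%N ->
  exists (q : nat) (alpha : int), [/\ (0 < q <= Q)%N, coprimez alpha q &
    `|q%:R * tau - alpha%:~R| <= Q%:R^-1].
Proof.
move=> Q0; have Q0R : 0 < Q%:R :> R by rewrite ltr0n.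
pose fr (k : nat) := k%:R * tau - (Num.floor (k%:R * tau))%:~R : R.
have fr0 k : 0 <= fr k by rewrite subr_ge0 floor_le.
have fr1 k : fr k < 1 by rewrite ltrBlDl; have := floorD1_gt (k%:R * tau); rewrite intrD.
have lt k : (Num.truncn (Q%:R * fr k) < Q)%N.
  by rewrite truncn_lt_nat ?mulr_ge0// gtr_pMr.
pose f (k : 'I_Q.+1) : 'I_Q := Ordinal (lt k).
have : ~~ injectiveb f.
  by apply/negP => /injectiveP /leq_card; rewrite !card_ord ltnn.
move=> /injectivePn[i [j ji fij]].
have close (k l : 'I_Q.+1) : f k = f l -> fr k - fr l <= Q%:R^-1.
  move=> /(congr1 val) /= E.
  rewrite -[leRHS]mul1r ler_pdivlMr// mulrC mulrBr lerBlDr.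
  have /andP[_ /ltW] := truncn_itv (mulr_ge0 (ltW Q0R) (fr0 k)).
  have /andP[] := truncn_itv (mulr_ge0 (ltW Q0R) (fr0 l)).
  by rewrite -E -natr1; lra.
have [q [a [q0 qQ qa]]] : exists (q : nat) (a : int), [/\ (0 < q)%N, (q <= Q)%N &
    `|q%:R * tau - a%:~R| <= Q%:R^-1].
  wlog lij : i j ji fij / (i < j)%N.
    move=> H; have [ij|ij|ij] := ltngtP i j; first exact: (H i j).
      by apply: (H j i) => //; rewrite eq_sym.
    by move: ji; rewrite (val_inj ij) eqxx.
  exists (j - i)%N, (Num.floor (j%:R * tau) - Num.floor (i%:R * tau)).
  rewrite subn_gt0 lij; split=> //.
    by rewrite (leq_trans (leq_subr _ _))// -ltnS.
  rewrite natrB 1?ltnW// rmorphB /= mulrBl.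
  have -> : forall a b c d : R, a - b - (c - d) = (a - c) - (b - d) by move=> *; ring.
  by rewrite -/(fr j) -/(fr i) ler_norml lerNl opprB !close.
(* Dividing numerator and denominator by their gcd divides the error by it as well, so the bound
   survives. *)
pose g := gcdn q `|a|.
have g0 : (0 < g)%N by rewrite gcdn_gt0 q0.
have gq : (g %| q)%N by rewrite dvdn_gcdl.
have ga : (g %| a)%Z by rewrite dvdzE dvdn_gcdr.
have qE : q = (g * (q %/ g))%N by rewrite mulnC divnK.
have aE : a = g%:Z * (a %/ g)%Z by rewrite mulrC divzK.
exists (q %/ g)%N, (a %/ g)%Z; split.
- by rewrite divn_gt0// dvdn_leq//= (leq_trans (leq_div _ _)).
- rewrite /coprimez /gcdz /=.
  have : (g * gcdn `|(a %/ g)%Z| (q %/ g) == g * 1)%N.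
    by rewrite muln_gcdr -qE -[X in (X * _)%N](absz_nat g) -abszM -aE gcdnC muln1.
  by rewrite eqn_pmul2l// => /eqP ->.
- apply: le_trans qa; rewrite {2}qE {2}aE natrM rmorphM /= -mulrA -mulrBr normrM.
  by rewrite ler_peMl// ger0_norm// ler1n.
Qed.

Lemma sum_multiples (V : nmodType) (q N : nat) (F : nat -> V) : (0 < q)%N ->
  \sum_(1 <= h < N | (q %| h)%N) F h = \sum_(l < N.-1 %/ q) F (q * l.+1)%N.
Proof.
move=> q0; case: N => [|N]; first by rewrite big_geq// div0n big_ord0.
elim: N => [|N IH]; first by rewrite big_geq// div0n big_ord0.
rewrite big_mkcond big_nat_recr//= -big_mkcond IH /= divnS//.
case: ifP => qN /=; last by rewrite addr0 add0n.
rewrite big_ord_recr /=; congr (_ + F _).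
by rewrite -(divnK qN) divnS// qN mulnC.
Qed.

Lemma sum_periodic (R : realType) (q B : nat) (G : nat -> R) :
  (forall i, G (q + i)%N = G i) ->
  \sum_(i < B * q) G i = B%:R * \sum_(i < q) G i.
Proof.
move=> h; elim: B => [|B IH]; first by rewrite mul0n big_ord0 mul0r.
rewrite -natr1 mulrDl mul1r -IH mulSn big_split_ord /= addrC; congr (_ + _).
by apply: eq_bigr => i _; rewrite h.
Qed.

Lemma sum_mul_mod (R : realType) (q a : nat) (G : nat -> R) :
  (0 < q)%N -> coprime a q ->
  \sum_(i < q) G ((i * a) %% q)%N = \sum_(i < q) G i.
Proof.
move=> q0 aq.
pose f (i : 'I_q) : 'I_q := Ordinal (ltn_pmod (i * a) q0).
have fi : injective f.
  move=> i j /(congr1 val) /= /eqP E; apply/val_inj/eqP.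
  wlog ij : i j E / (i <= j)%N.
    move=> H; have [ij|/ltnW ij] := leqP i j; first exact: H.
    by rewrite eq_sym; apply: H => //; rewrite eq_sym.
  move: E; rewrite eq_sym eqn_mod_dvd ?leq_mul2r ?ij ?orbT// -mulnBl Gauss_dvdl 1?coprime_sym//.
  case: (posnP (j - i)) => [/eqP|ji /(dvdn_leq ji)].
    by rewrite subn_eq0 => ji _; rewrite eqn_leq ij.
  by move=> h; exfalso; have := ltn_ord j; lia.
by rewrite [RHS](reindex_inj fi).
Qed.

(** For q not dividing h, the residue r of h alpha modulo q is nonzero, so h tau keeps distance at
    least min (r, q - r) / (2q) from the integers and the geometric sum is at most 2q / min (r, q -
    r). Over q consecutive h the residues run through all classes, which costs O (q ell) per
    block. *)
Lemma sum_nonmultiples (R : realType) (N q : nat) (alpha : int) (tau ell : R) :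
  (0 < q <= 2 * N)%N -> coprimez alpha q ->
  `|q%:R * tau - alpha%:~R| <= (2 * N)%:R^-1 -> harm R (2 * N) <= ell ->
  \sum_(1 <= h < N | ~~ (q %| h)%N)
     normc (\sum_(i < N - h) e (i.+1%:R * (h%:R * tau))) <= 12 * N%:R * ell.
Proof.
move=> /andP[q0 qN] aq qtau ellN.
have N0 : (0 < N)%N by lia.
have q0R : 0 < q%:R :> R by rewrite ltr0n.
pose a := `|(alpha %% q)%Z|%N.
have aE : (a%:Z = (alpha %% q)%Z) by rewrite /a gez0_abs// modz_ge0//; lia.
have aq' : coprime a q.
  by move: aq; rewrite /coprimez -gcdz_modl -aE.
(* This sum replaces 1 / min (r, q - r). By the convention [0^-1 = 0] it is harmless at r = 0, so
   complete periods can be summed. *)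
pose G (r : nat) : R := r%:R^-1 + (q - r)%:R^-1.
have G0 r : 0 <= G r by rewrite addr_ge0 ?invr_ge0.
have term h : (1 <= h < N)%N -> ~~ (q %| h)%N ->
  normc (\sum_(i < N - h) e (i.+1%:R * (h%:R * tau))) <= 2 * q%:R * G ((h * a) %% q)%N.
  move=> /andP[h1 hN] qh.
  set r := ((h * a) %% q)%N.
  have rq : (r < q)%N by rewrite ltn_mod.
  have r0 : (0 < r)%N.
    rewrite lt0n; apply: contra qh => /eqP r0; have : (q %| h * a)%N by rewrite /dvdn -/r r0.
    by rewrite Gauss_dvdl// coprime_sym.
  pose mi := minn r (q - r).
  have mi0 : (0 < mi)%N by rewrite /mi; lia.
  have mi0R : 0 < mi%:R :> R by rewrite ltr0n.
  have [k hk] : exists k : int, h%:Z * alpha = r%:Z + q%:Z * k.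
    exists (h%:Z * (alpha %/ q)%Z + ((h * a) %/ q)%N%:Z).
    have E1 := divz_eq alpha q; rewrite -aE in E1.
    have E2 := divn_eq (h * a) q; rewrite -/r in E2.
    have E3 : h%:Z * a%:Z = ((h * a) %/ q)%N%:Z * q%:Z + r%:Z.
      by rewrite -!PoszM -PoszD -E2.
    rewrite {1}E1 mulrDr E3; ring.
  have lower (m : int) : mi%:R / (2 * q%:R) <= `|h%:R * tau - m%:~R|.
    have h2 : (mi%:R : R) <= `|(h%:Z * alpha - q%:Z * m)%:~R|.
      rewrite -intr_norm -[leLHS]/(mi%:Z%:~R) ler_int hk.
      rewrite /mi.
      have [ki|ki] : (k - m >= 0 \/ k - m <= -1) by lia.
        by rewrite ger0_norm; nia.
      by rewrite ler0_norm; nia.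
    have h3 : `|(h%:Z * alpha - q%:Z * m)%:~R| <= q%:R * `|h%:R * tau - m%:~R| + h%:R * `|q%:R * tau - alpha%:~R| :> R.
      have -> : (h%:Z * alpha - q%:Z * m)%:~R = q%:R * (h%:R * tau - m%:~R) - h%:R * (q%:R * tau - alpha%:~R) :> R.
        by rewrite rmorphB /= !rmorphM /= ; ring.
      by apply: (le_trans (ler_normB _ _)); rewrite !normrM !(@ger0_norm _ (_%:R)).
    (* Since h < N, the approximation error is at most 1/2, half of the least possible value of
       [mi]; this is the factor 2 lost in [lower]. *)
    have h4 : h%:R * `|q%:R * tau - alpha%:~R| <= 2^-1 :> R.
      apply: (@le_trans _ _ (N%:R * (2 * N)%:R^-1)).
        by apply: ler_pM => //; rewrite ler_nat ltnW.
      by rewrite natrM invfM mulrCA divff ?mulr1// pnatr_eq0 -lt0n.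
    rewrite ler_pdivrMr ?mulr_gt0//.
    have : 1 <= mi%:R :> R by rewrite ler1n.
    by lra.
  apply: (le_trans (geometric_sum_e _ _ lower)); first by rewrite divr_gt0// mulr_gt0.
  rewrite invf_div ler_pM2l ?mulr_gt0// /G /mi /minn.
  by case: ifP => _; rewrite ?lerDl ?lerDr invr_ge0.
apply: (@le_trans _ _ (\sum_(i < (N %/ q).+1 * q) (2 * q%:R * G ((i * a) %% q)%N))).
  rewrite -(big_mkord xpredT (fun i => 2 * q%:R * G ((i * a) %% q)%N)).
  have Nq : (N <= (N %/ q).+1 * q)%N by rewrite ltnW// ltn_ceil.
  rewrite [leRHS](@big_cat_nat _ _ _ 1%N)//=; last by lia.
  rewrite [X in _ + X](@big_cat_nat _ _ _ N)//=.
  have Gs m n : 0 <= \sum_(m <= i < n) 2 * q%:R * G ((i * a) %% q)%N.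
    by rewrite sumr_ge0// => i _; rewrite mulr_ge0// mulr_ge0.
  apply: (@le_trans _ _ (\sum_(1 <= i < N) (2 * q%:R * G ((i * a) %% q)%N))).
    rewrite big_mkcond /= big_nat_cond [leRHS]big_nat_cond; apply: ler_sum => h /andP[hN _].
    by case: ifP => hq; [exact: term | rewrite mulr_ge0// mulr_ge0].
  by rewrite addrCA lerDl addr_ge0.
rewrite -mulr_sumr (sum_periodic (q := q) _ (G := fun i => G ((i * a) %% q)%N)); last first.
  by move=> i; rewrite mulnDl mulnC modnMDl.
rewrite sum_mul_mod//.
have GH : \sum_(i < q) G i <= 2 * ell.
  rewrite big_split /= mulr_natl mulr2n; apply: lerD.
    apply: le_trans ellN; apply: (le_trans _ (le_harm R qN)).
    case: {qN aq qtau q0R a aE aq' G G0 term} q q0 => // q _.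
    rewrite big_ord_recl /= invr0 add0r.
    exact: (le_harm R (leqnSn q)).
  apply: le_trans ellN; apply: (le_trans _ (le_harm R qN)).
  rewrite (reindex_inj rev_ord_inj) /=; apply: ler_sum => i _.
  by rewrite subKn.
have B : (N %/ q).+1%:R * q%:R <= 3 * N%:R :> R.
  rewrite -!natrM ler_nat mulSn; have := leq_trunc_div N q; lia.
have ell0 : 0 <= ell by apply: le_trans ellN; exact: harm_ge0.
apply: (@le_trans _ _ (2 * q%:R * ((N %/ q).+1%:R * (2 * ell)))).
  by rewrite ler_pM2l ?mulr_gt0// ler_pM2l.
have : (N %/ q).+1%:R * q%:R * ell <= 3 * N%:R * ell by rewrite ler_wpM2r.
by lra.
Qed.

(** * The inverse theorem for quadratic Weyl sums *)

Definition weyl_kernel (R : realType) (N : nat) (x t : R) : R[i] :=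
  \sum_(i < N) e (i.+1%:R * x + i.+1%:R ^+ 2 * t).

(** The shifts h = q (l + 1) of the differenced square of the kernel. For them h (2t) is close to an
    integer, and the sum over i need not be small. The lemmas [multiples_part_le1],
    [multiples_part_le2] and [multiples_part_le3] bound this one quantity in order to control,
    respectively, q, the error in t and the error in x. *)
Definition multiples_part (R : realType) (N q : nat) (x t : R) : R[i] :=
  \sum_(l < N.-1 %/ q) \sum_(i < N - q * l.+1)
     e ((q * l.+1)%:R * x + (q * l.+1)%:R ^+ 2 * t + i.+1%:R * ((q * l.+1)%:R * (2 * t))).

Lemma weyl_kernel_sqr_le (R : realType) (N q : nat) (alpha : int) (x t ell : R) :
  (0 < q <= 2 * N)%N -> coprimez alpha q ->
  `|q%:R * (2 * t) - alpha%:~R| <= (2 * N)%:R^-1 -> harm R (2 * N) <= ell ->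
  normc (weyl_kernel N x t) ^+ 2 <=
  N%:R + 24 * N%:R * ell + 2 * normc (multiples_part N q x t).
Proof.
move=> qN aq qt ellN; have /andP[q0 _] := qN.
pose z i : R[i] := e (i.+1%:R * x + i.+1%:R ^+ 2 * t).
apply: (le_trans (@weyl_differencing _ z N _)); first by move=> i; rewrite normc_e.
rewrite -addrA lerD2l.
pose D h : R[i] := \sum_(i < N - h) e (h%:R * x + h%:R ^+ 2 * t + i.+1%:R * (h%:R * (2 * t))).
have DE h : \sum_(i < N - h) z (i + h)%N * ((z i)^*)%C = D h.
  apply: eq_bigr => i _; rewrite /z -eN -eD; congr e.
  by rewrite -addSn natrD; ring.
have nD h : normc (D h) = normc (\sum_(i < N - h) e (i.+1%:R * (h%:R * (2 * t)))).
  rewrite /D (eq_bigr (fun i : 'I__ => e (h%:R * x + h%:R ^+ 2 * t) * e (i.+1%:R * (h%:R * (2 * t))))).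
    by rewrite -mulr_sumr ComplexField.Normc.normcM normc_e mul1r.
  by move=> i _; rewrite eD.
under eq_bigr => h _ do rewrite DE.
rewrite (bigID (fun h => (q %| h)%N)) /= (sum_multiples N D q0) -/(multiples_part N q x t).
have := normcD_le (multiples_part N q x t) (\sum_(1 <= h < N | ~~ (q %| h)%N) D h).
have := normc_sum (index_iota 1 N) (fun h => ~~ (q %| h)%N) D.
under [X in _ <= X -> _]eq_bigr => h _ do rewrite nD.
have := sum_nonmultiples qN aq qt ellN.
by lra.
Qed.

Lemma multiples_part_le1 (R : realType) (N q : nat) (x t : R) : (0 < q)%N ->
  normc (multiples_part N q x t) <= N%:R ^+ 2 / q%:R.
Proof.
move=> q0; apply: (le_trans (normc_sum _ _ _)).
apply: (@le_trans _ _ (\sum_(l < N.-1 %/ q) N%:R)).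
  apply: ler_sum => l _; apply: (le_trans (normc_sum _ _ _)).
  under eq_bigr => i _ do rewrite normc_e.
  by rewrite sumr_const card_ord ler_nat leq_subr.
rewrite sumr_const card_ord -[leLHS]mulr_natl expr2 ler_pdivlMr ?ltr0n// mulrAC.
rewrite ler_wpM2r// -natrM ler_nat.
by have := leq_trunc_div N.-1 q; lia.
Qed.

(** Modulo 1 the frequency of the sum over i is (l + 1) eta with eta = q (2t) - alpha. It is at most
    1/2 in modulus, so it is its own distance to the integers, and the geometric sums 1 / ((l + 1)
    |eta|) add up to a harmonic sum. *)
Lemma multiples_part_le2 (R : realType) (N q : nat) (alpha : int) (x t : R) :
  (0 < q <= 2 * N)%N -> q%:R * (2 * t) - alpha%:~R != 0 ->
  `|q%:R * (2 * t) - alpha%:~R| <= (2 * N)%:R^-1 ->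
  normc (multiples_part N q x t) <= harm R N / `|q%:R * (2 * t) - alpha%:~R|.
Proof.
set eta := q%:R * (2 * t) - alpha%:~R => /andP[q0 qN] eta0 etaN.
have N0 : (0 < N)%N by lia.
apply: (le_trans (normc_sum _ _ _)).
apply: (@le_trans _ _ (\sum_(l < N.-1 %/ q) l.+1%:R^-1 * `|eta|^-1)); last first.
  rewrite -mulr_suml ler_wpM2r ?invr_ge0//; apply: (@le_harm R).
  by rewrite (leq_trans (leq_div _ _))// leq_pred.
apply: ler_sum => l _; set h := (q * l.+1)%N.
rewrite (eq_bigr (fun i : 'I__ => e (h%:R * x + h%:R ^+ 2 * t) * e (i.+1%:R * (h%:R * (2 * t))))); last first.
  by move=> i _; rewrite eD.
rewrite -mulr_sumr ComplexField.Normc.normcM normc_e mul1r -invfM.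
apply: geometric_sum_e; first by rewrite mulr_gt0// normr_gt0.
move=> m.
have hN : (h <= N)%N.
  by have := ltn_ord l; have := leq_trunc_div N.-1 q; rewrite /h; nia.
have lN : l.+1%:R * `|eta| <= 2^-1.
  apply: (@le_trans _ _ (N%:R * (2 * N)%:R^-1)).
    by apply: ler_pM => //; rewrite ler_nat; rewrite /h in hN; nia.
  by rewrite natrM invfM mulrCA divff ?mulr1// pnatr_eq0 -lt0n.
have -> : h%:R * (2 * t) - m%:~R = l.+1%:R * eta - (m - l.+1%:Z * alpha)%:~R.
  by rewrite /h natrM rmorphB rmorphM /= /eta; ring.
set k := m - _; have [->|k0] := eqVneq k 0.
  by rewrite subr0 normrM ger0_norm.
have k1 : 1 <= `|k%:~R| :> R by rewrite -intr_norm ler1z; lia.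
have : `|k%:~R| <= `|l.+1%:R * eta| + `|l.+1%:R * eta - k%:~R|.
  by rewrite -{1}[k%:~R](subKr (l.+1%:R * eta)) ler_normB.
by rewrite normrM ger0_norm//; lra.
Qed.

(** The order of summation is exchanged. For fixed i the phase is quadratic in l, and its increments
    are q x + q alpha / 2 up to an integer and an error of at most 3 N |eta|. If they avoid the
    integers, [kusmin_landau] applies; the two previous bounds do not see x at all. *)
Lemma multiples_part_le3 (R : realType) (N q : nat) (alpha : int) (x t c : R) :
  (0 < q)%N -> 0 < c ->
  3 * N%:R * `|q%:R * (2 * t) - alpha%:~R| <= c ->
  (forall m : int, 2 * c <= `|q%:R * x + q%:R * alpha%:~R / 2 - m%:~R|) ->
  normc (multiples_part N q x t) <= 5 * N%:R / c.
Proof.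
set eta := q%:R * (2 * t) - alpha%:~R => q0 c0 etac hm.
pose F (i l : nat) : R[i] := e ((q * l.+1)%:R * x + (q * l.+1)%:R ^+ 2 * t + i.+1%:R * ((q * l.+1)%:R * (2 * t))).
have -> : multiples_part N q x t = \sum_(i < N) \sum_(l < (N - i).-1 %/ q) F i l.
  rewrite /multiples_part.
  transitivity (\sum_(l < N.-1 %/ q) \sum_(i < N | (i < N - q * l.+1)%N) F i l).
    by apply: eq_bigr => l _; rewrite (big_ord_widen N (fun i => F i l))// leq_subr.
  rewrite (exchange_big_dep xpredT)//=; apply: eq_bigr => i _.
  rewrite (big_ord_widen (N.-1 %/ q) (fun l => F i l)); last by apply: leq_div2r; have := ltn_ord i; lia.
  apply: eq_bigl => l; rewrite leq_divRL//.
  by have := ltn_ord i; rewrite mulnC; lia.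
apply: (le_trans (normc_sum _ _ _)).
apply: (@le_trans _ _ (\sum_(i < N) (5 / c))); last first.
  by rewrite sumr_const card_ord -[leLHS]mulr_natl mulrA [X in X / _]mulrC.
apply: ler_sum => i _.
(* The empty sum is set apart because n >= 1 gives q <= q n < N, from which [u] is bounded by 3N
   below. *)
have [n0|n0] := posnP ((N - i).-1 %/ q).
  by rewrite n0 big_ord0 ComplexField.Normc.normc0 divr_ge0// ltW.
pose n := ((N - i).-1 %/ q)%N.
have nq : (q * n <= (N - i).-1)%N by rewrite mulnC leq_trunc_div.
have iN := ltn_ord i.
have qtau : q%:R * (2 * t) = eta + alpha%:~R by rewrite /eta subrK.
apply: (@kusmin_landau R (fun l => (q * l.+1)%:R * x + (q * l.+1)%:R ^+ 2 * t + i.+1%:R * ((q * l.+1)%:R * (2 * t)))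
   n c (q%:R * `|eta|)) => //.
- apply: le_trans etac; rewrite mulrA ler_wpM2r// -!natrM ler_nat.
  by rewrite mulnC; lia.
- move=> l m ln.
  pose k : int := m - q%:Z * l.+1%:Z * alpha - i.+1%:Z * alpha.
  pose u : R := q%:R * (2 * l%:R + 3) / 2 + i.+1%:R.
  have -> : (q * l.+2)%:R * x + (q * l.+2)%:R ^+ 2 * t + i.+1%:R * ((q * l.+2)%:R * (2 * t)) -
    ((q * l.+1)%:R * x + (q * l.+1)%:R ^+ 2 * t + i.+1%:R * ((q * l.+1)%:R * (2 * t))) - m%:~R
    = (q%:R * x + q%:R * alpha%:~R / 2 - k%:~R) + u * eta.
    have e1 : (q * l.+1)%:R = q%:R * (l%:R + 1) :> R by rewrite natrM natr1.
    have e2 : (q * l.+2)%:R = q%:R * (l%:R + 2) :> R by rewrite natrM -addn2 natrD.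
    have e3 : k%:~R = m%:~R - q%:R * (l%:R + 1) * alpha%:~R - i.+1%:R * alpha%:~R :> R.
      by rewrite /k !rmorphB /= !rmorphM /= natr1.
    by rewrite e1 e2 e3 /u /eta; field.
  have u0 : 0 <= u by rewrite addr_ge0// divr_ge0// mulr_ge0// addr_ge0// mulr_ge0.
  have u3 : u <= 3 * N%:R.
    have h1 : (q * (2 * l + 3) + 2 * i.+1)%:R <= (6 * N)%:R :> R.
      rewrite ler_nat.
      have : (q <= q * n)%N by rewrite leq_pmulr.
      have : (q * l <= q * n)%N by rewrite leq_mul2l ln orbT.
      lia.
    move: h1; rewrite natrD !natrM natrD natrM /u; lra.
  have h2 : `|u * eta| <= c.
    by rewrite normrM (ger0_norm u0) (le_trans _ etac)// ler_wpM2r.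
  have := hm k; set w := q%:R * x + q%:R * alpha%:~R / 2 - k%:~R.
  have : `|w| <= `|w + u * eta| + `|u * eta|.
    by rewrite -{1}[w](addrK (u * eta)) ler_normB.
  by lra.
- move=> l; exists (q%:Z * alpha).
  set w := (X in `|X| <= _); suff -> : w = q%:R * eta by rewrite normrM ger0_norm.
  rewrite /w.
  have e1 : (q * l.+1)%:R = q%:R * (l%:R + 1) :> R by rewrite natrM natr1.
  have e2 : (q * l.+2)%:R = q%:R * (l%:R + 2) :> R by rewrite natrM -addn2 natrD.
  have e3 : (q * l.+3)%:R = q%:R * (l%:R + 3) :> R by rewrite natrM -addn3 natrD.
  by rewrite e1 e2 e3 /eta rmorphM /=; ring.
Qed.

(** Dirichlet approximation of 2t, after which the three upper bounds for [multiples_part] are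
    compared with its lower bound, a quarter of the squared kernel. The constant 80 is the 40 from
    the bound on x, doubled in the case where the denominator is doubled. *)
Lemma weyl_inverse (R : realType) (N : nat) (x t ell : R) :
  (0 < N)%N -> 1 <= ell -> harm R (2 * N) <= ell ->
  50 * ell * N%:R <= normc (weyl_kernel N x t) ^+ 2 ->
  exists (q : nat) (alpha m : int),
  let p := 80 * ell * N%:R ^+ 2 / normc (weyl_kernel N x t) ^+ 2 in
  [/\ (0 < q)%N, coprimez alpha q, q%:R <= p,
    `|q%:R * x - m%:~R| <= p / N%:R & `|q%:R * t - alpha%:~R| <= p / N%:R ^+ 2].
Proof.
move=> N0 ell1 ellN; set K := normc (weyl_kernel N x t) ^+ 2 => KN.
have N0R : 0 < N%:R :> R by rewrite ltr0n.
have N1R : 1 <= N%:R :> R by rewrite ler1n.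
have lN : N%:R <= ell * N%:R by rewrite ler_peMl// ltW.
have K0 : 0 < K by lra.
have [|q [a [qN aq qa]]] := @dirichlet_approximation R (2 * t) (2 * N); first by rewrite muln_gt0.
have /andP[q0 _] := qN.
have q0R : 0 < q%:R :> R by rewrite ltr0n.
set T := normc (multiples_part N q x t).
(* The assumption with constant 50 absorbs N + 24 N ell <= 25 N ell into half of [K]. *)
have TK : K / 4 <= T.
  have := weyl_kernel_sqr_le x qN aq qa ellN; rewrite -/K -/T; lra.
have T0 : 0 < T by apply: lt_le_trans TK; rewrite divr_gt0.
have qK : q%:R <= 4 * N%:R ^+ 2 / K.
  have := multiples_part_le1 N x t q0; rewrite -/T ler_pdivlMr// => h.
  rewrite ler_pdivlMr//; have := ler_wpM2r (ltW q0R) TK; lra.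
set eta := q%:R * (2 * t) - a%:~R.
have etaK : `|eta| <= 4 * ell / K.
  have [->|eta0] := eqVneq eta 0; first by rewrite normr0 divr_ge0 ?ltW//; lra.
  have e0 : 0 < `|eta| by rewrite normr_gt0.
  have := multiples_part_le2 x qN eta0 qa; rewrite -/T ler_pdivlMr// => h.
  have := le_harm R (leq_pmull N (isT : (0 < 2)%N)) => h2.
  rewrite ler_pdivlMr//; have := ler_wpM2r (ltW e0) TK; lra.
pose theta := q%:R * x + q%:R * a%:~R / 2.
have [m [_ mmin]] := nearest_int theta.
set D := `|theta - m%:~R|.
(* Otherwise [multiples_part_le3] applies with c = D / 2, because [D] is the least distance of
   [theta] to an integer, and gives T <= 10 N / D, against T >= K / 4. *)
have DK : D <= 40 * (N%:R * ell) / K.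
  rewrite leNgt; apply/negP => DK.
  have DK' : 40 * (N%:R * ell) < D * K by rewrite -ltr_pdivrMr.
  have D0 : 0 < D.
    by rewrite -(pmulr_lgt0 _ K0); apply: lt_trans DK'; rewrite !mulr_gt0//; lra.
  have eK : `|eta| * K <= 4 * ell by rewrite -ler_pdivlMr.
  have : T <= 5 * N%:R / (D / 2).
    apply: (@multiples_part_le3 _ _ _ a) => //; first by rewrite divr_gt0.
      rewrite -/eta -(ler_pM2r K0).
      have := ler_wpM2l (ltW N0R) eK; lra.
    by move=> m'; have := mmin m'; rewrite -/D /theta; lra.
  rewrite ler_pdivlMr ?divr_gt0// => h.
  have : K / 4 * (D / 2) <= T * (D / 2) by rewrite ler_wpM2r// ltW// divr_gt0.
  lra.
have KV : 0 < K^-1 by rewrite invr_gt0.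
have l2 : N%:R ^+ 2 / K <= ell * N%:R ^+ 2 / K.
  by rewrite ler_pM2r// ler_peMl// exprn_ge0// ltW.
have eN : 80 * ell * N%:R ^+ 2 / K / N%:R ^+ 2 = 80 * ell / K.
  by field; rewrite !gt_eqF.
have eN1 : 80 * ell * N%:R ^+ 2 / K / N%:R = 80 * (N%:R * ell) / K.
  by field; rewrite !gt_eqF.
have l3 : 0 < ell / K by rewrite divr_gt0//; lra.
have l4 : 0 < N%:R ^+ 2 / K by rewrite divr_gt0// exprn_gt0.
(* The fraction a / q approximates 2t. For odd a the fraction for t is a / (2q), still reduced; for
   even a it is (a / 2) / q, and then q a / 2 is an integer that can be moved into m. *)
have [aodd|aeven] := boolP (2 %| a)%Z; last first.
  exists (2 * q)%N, a, (2 * m - q%:Z * a) => /=.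
  rewrite eN eN1; split.
  - by rewrite muln_gt0.
  - rewrite /coprimez PoszM.
    have -> : gcdz a (2%:Z * q%:Z) = gcdz a 2.
      by apply/eqP; rewrite Gauss_gcdzl.
    rewrite -/(coprimez a 2) coprimez_sym /coprimez.
    have := aeven; rewrite /gcdz dvdzE /= => h.
    by rewrite eqz_nat -/(coprime 2 `|a|) prime_coprime.
  - by rewrite natrM; lra.
  - have -> : (2 * q)%:R * x - (2 * m - q%:Z * a)%:~R = 2 * (theta - m%:~R).
      by rewrite /theta natrM rmorphB !rmorphM /=; field.
    rewrite normrM ger0_norm// -/D; lra.
  - have -> : (2 * q)%:R * t - a%:~R = eta by rewrite /eta natrM; ring.
    lra.
have [b ab] : exists b, a = 2 * b by exists (a %/ 2)%Z; rewrite mulrC divzK.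
exists q, b, (m - q%:Z * b) => /=.
rewrite eN eN1; split=> //.
- by move: aq; rewrite ab coprimezMl => /andP[].
- by lra.
- have -> : q%:R * x - (m - q%:Z * b)%:~R = theta - m%:~R.
    by rewrite /theta ab rmorphB !rmorphM /=; field.
  rewrite -/D; have := normr_ge0 (theta - m%:~R); rewrite -/D; lra.
- have -> : q%:R * t - b%:~R = eta / 2 by rewrite /eta ab rmorphM /=; field.
  rewrite normrM (ger0_norm (_ : 0 <= 2^-1))//; have := normr_ge0 eta; lra.
Qed.

(** * Counting the third vertex of a triangle *)

(** With truncated subtraction [(k - i0) + (i0 - k)] is |k - i0|. Each side of i0 contributes a
    harmonic sum and the centre contributes 1. *)
Lemma sum_inv_dist_nat (R : realType) (N i0 : nat) (ell : R) : (i0 <= N)%N ->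
  1 <= ell -> harm R N <= ell ->
  \sum_(k < N) (maxn 1 ((k - i0) + (i0 - k)))%:R^-1 <= 3 * ell.
Proof.
move=> iN l1 lN.
rewrite -(big_mkord xpredT (fun k => (maxn 1 ((k - i0) + (i0 - k)))%:R^-1 : R)).
rewrite (@big_cat_nat _ _ _ i0)//=.
have h1 : \sum_(0 <= k < i0) (maxn 1 ((k - i0) + (i0 - k)))%:R^-1 <= ell.
  apply: le_trans lN; apply: le_trans (le_harm R iN).
  rewrite big_nat_rev big_mkord /harm ler_sum// => k _; have := ltn_ord k => ki.
  rewrite lef_pV2 ?posrE ?ltr0n ?leq_max// ler_nat; lia.
have h2 : \sum_(i0 <= k < N) (maxn 1 ((k - i0) + (i0 - k)))%:R^-1 <= 1 + ell.
  rewrite -{1}(add0n i0) big_addn.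
  apply: (@le_trans _ _ (1 + harm R (N - i0))); last first.
    by rewrite lerD2l (le_trans _ lN)// le_harm// leq_subr.
  case: (N - i0)%N => [|n]; first by rewrite big_geq// addr_ge0// harm_ge0.
  rewrite big_nat_recl//= lerD//.
    by rewrite invf_le1 ?ltr0n ?ler1n leq_max.
  rewrite big_mkord; apply: le_trans (le_harm R (leqnSn n)).
  rewrite ler_sum// => k _.
  rewrite lef_pV2 ?posrE ?ltr0n ?leq_max// ler_nat; lia.
lra.
Qed.

(** Let i0 be the integer part of y, clamped to [0, N]. Then |xi k - y| >= |k - i0| - 1, and max (1,
    n - 1) >= n / 2 for every n, so passing to integer distances costs a factor 2. *)
Lemma sum_inv_dist (R : realType) (N : nat) (xi : nat -> R) (y ell : R) :
  1 <= ell -> harm R N <= ell ->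
  (forall k, (k < N)%N -> k%:R <= xi k <= k%:R + 1) ->
  \sum_(k < N) (Num.max 1 `|xi k - y|)^-1 <= 6 * ell.
Proof.
move=> l1 lN hxi.
suff [i0 iN hi] : exists2 i0, (i0 <= N)%N & forall k, (k < N)%N ->
    (maxn 1 ((k - i0) + (i0 - k)))%:R / 2 <= Num.max 1 `|xi k - y| :> R.
  apply: (@le_trans _ _ (\sum_(k < N) 2 * (maxn 1 ((k - i0) + (i0 - k)))%:R^-1)).
    apply: ler_sum => k _; rewrite -[X in X * _]invrK -invfM mulrC.
    rewrite lef_pV2 ?posrE; first exact: hi.
      by rewrite (@lt_le_trans _ _ 1)// le_max lexx.
    by rewrite divr_gt0// ltr0n leq_max.
  by rewrite -mulr_sumr; have := sum_inv_dist_nat iN l1 lN; lra.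
have bound (i0 k : nat) (d : R) : (i0%:R - k%:R - 1 <= d) -> (k%:R - i0%:R - 1 <= d) ->
   (maxn 1 ((k - i0) + (i0 - k)))%:R / 2 <= Num.max 1 d :> R.
  move=> h1 h2; rewrite le_max; apply/orP.
  have [sm|bg] := leqP (maxn 1 ((k - i0) + (i0 - k))) 2.
    by left; rewrite ler_pdivrMr// mul1r ler_nat.
  right; rewrite ler_pdivrMr//.
  have [ki|ik] := leqP k i0.
    have -> : maxn 1 ((k - i0) + (i0 - k)) = (i0 - k)%N by lia.
    have : (3 <= i0 - k)%N by lia.
    by rewrite -(ler_nat R) natrB//; lra.
  have -> : maxn 1 ((k - i0) + (i0 - k)) = (k - i0)%N by lia.
  have : (3 <= k - i0)%N by lia.
  by rewrite -(ler_nat R) natrB// 1?ltnW//; lra.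
have [yN|yN] := leP N%:R y.
  exists N => // k kN; have /andP[k1 k2] := hxi _ kN; apply: bound.
    by rewrite ler_normr; apply/orP; right; lra.
  have : k%:R <= N%:R :> R by rewrite ler_nat ltnW.
  by have := normr_ge0 (xi k - y); lra.
have [y0|y0] := leP 0 y; last first.
  exists 0%N => // k kN; have /andP[k1 k2] := hxi _ kN; apply: bound.
    have : 0 <= k%:R :> R by [].
    by have := normr_ge0 (xi k - y); lra.
  by rewrite ler_normr; apply/orP; left; lra.
have /andP[t1 t2] := truncn_itv y0; rewrite -natr1 in t2.
exists (Num.truncn y).
  by rewrite -(ler_nat R); lra.
move=> k kN; have /andP[k1 k2] := hxi _ kN; apply: bound.
  by rewrite ler_normr; apply/orP; right; lra.
by rewrite ler_normr; apply/orP; left; lra.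
Qed.

Definition zrange (B : nat) : seq int := [seq i%:Z - B%:Z | i <- iota 0 (2 * B).+1].

Lemma mem_zrange (B : nat) (j : int) : (j \in zrange B) = (`|j| <= B)%N.
Proof.
apply/mapP/idP => [[i + ->] | jB]; first by rewrite mem_iota; lia.
exists (absz (j + B%:Z)); first by rewrite mem_iota; lia.
by lia.
Qed.

Lemma size_zrange B : size (zrange B) = (2 * B).+1.
Proof. by rewrite size_map size_iota. Qed.

Lemma sum_zrange (R : realType) (B : nat) (ell : R) :
  1 <= ell -> harm R (2 * B).+1 <= ell ->
  \sum_(j <- zrange B) (Num.max 1 `|j%:~R|)^-1 <= 6 * ell.
Proof.
move=> l1 lB; rewrite big_map -[iota _ _]/(index_iota 0 (2 * B).+1) big_mkord.
apply: le_trans (sum_inv_dist (xi := fun k => k%:R) B%:R l1 lB _); last first.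
  by move=> k _; rewrite lexx lerDl ler01.
by apply: ler_sum => i _; rewrite rmorphB.
Qed.

Lemma le_sum_mem (R : numDomainType) (T : eqType) (s : seq T) (F : T -> R) (x : T) :
  x \in s -> (forall y, 0 <= F y) -> F x <= \sum_(y <- s) F y.
Proof. by move=> xs F0; rewrite (big_rem x xs) /= lerDl sumr_ge0. Qed.

(** Since b is invertible modulo c, two solutions differ by a multiple of c. Any solution in the
    range serves as base point; it depends on b, c, rho and A alone, which lets [count_third_vertex]
    fix it before the vertex. *)
Lemma residue_base (b c A : nat) (rho : int) : (0 < c)%N -> coprime b c ->
  exists m0 : int, forall m : int, (`|m| <= 2 * (A * c))%N ->
    (c %| b%:Z * m + rho)%Z -> exists k : int, (`|k| <= 4 * A)%N /\ m = m0 + c%:Z * k.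
Proof.
move=> c0 bc.
have [[m0 [m0A m0c]] | no] := pselect (exists m0 : int, (`|m0| <= 2 * (A * c))%N /\ (c %| b%:Z * m0 + rho)%Z); last first.
  by exists 0 => m mA mc; exfalso; apply: no; exists m.
exists m0 => m mA mc.
have : (c %| b%:Z * (m - m0))%Z.
  have -> : b%:Z * (m - m0) = (b%:Z * m + rho) - (b%:Z * m0 + rho) by ring.
  exact: rpredB.
rewrite Gauss_dvdzr; last by rewrite coprimez_sym.
move=> /dvdzP[k hk]; exists k; split; last by rewrite mulrC -hk; ring.
have : (`|k| * c <= 4 * A * c)%N by rewrite -[X in (_ * X)%N]absz_nat -abszM -hk; lia.
by rewrite leq_pmul2r.
Qed.

(* Up to the position of X u within a bounded number of cells, u is determined by
   the divisors d and b of q1, the integers a and j, and the integer k such that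
   m u = m0 + c k, where m0 solves a congruence modulo c. The weight of u is at most
   the product of 1 / (d a^2), 1 / max 1 |j| and 1 / max 1 (distance); summing over
   the O (d a) values of k leaves harmonic sums. *)
Lemma count_third_vertex (R : realType) (N : nat) (V : {set 'I_N}) (X : 'I_N -> R)
    (y ell : R) (mu : int) (q1 Q B : nat) (q2 q3 : 'I_N -> nat) (m : 'I_N -> int)
    (J w : 'I_N -> R) :
  (forall k, k \in V -> k%:R <= X k <= k%:R + 1) ->
  (0 < q1)%N -> 1 <= ell -> harm R N <= ell -> harm R Q <= ell ->
  harm R (2 * B).+1 <= ell -> (size (divisors q1))%:R <= ell ->
  (forall u, u \in V -> exists (d a b c : nat) (j : int),
    [/\ q1 = (d * b * c)%N, q2 u = (d * a * c)%N, q3 u = (d * a * b)%N,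
        coprime b c & (c %| b%:Z * m u + (j + a%:Z * mu))%Z] /\
    [/\ (0 < q2 u <= Q)%N, (0 < q3 u)%N, Num.max 1 `|j%:~R| <= J u, (`|j| <= B)%N &
        (`|m u| <= 2 * q2 u)%N]) ->
  (forall u, u \in V -> Num.max 1 `|X u - (y + N%:R * ((m u)%:~R / (q2 u)%:R))| <= w u) ->
  \sum_(u in V) q1%:R / ((q2 u)%:R * (q3 u)%:R) / J u / w u <= 324 * ell ^+ 5.
Proof.
move=> hX q10 l1 lN lQ lB ldiv data hw.
have ell0 : 0 < ell by lra.
pose P (x : nat * nat * int * nat) (m0 : int) := let: (b, c, rho, A) := x in
  (0 < c)%N -> coprime b c -> forall m : int, (`|m| <= 2 * (A * c))%N ->
    (c %| b%:Z * m + rho)%Z -> exists k : int, (`|k| <= 4 * A)%N /\ m = m0 + c%:Z * k.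
have /choice[m0 hm0] : forall x, exists y, P x y.
  move=> -[[[b c] rho] A] /=.
  have [c0|c0] := boolP (0 < c)%N; last by exists 0.
  have [bc|bc] := boolP (coprime b c); last by exists 0.
  by have [m0 h] := residue_base A rho c0 bc; exists m0.
(* The place where the parameters predict [X u]; c is recovered from q1, d and b. *)
pose z (d b a : nat) (j k : int) : R := let c := (q1 %/ (d * b))%N in
  y + N%:R * ((m0 (b, c, j + a%:Z * mu, (d * a)%N) + c%:Z * k)%:~R / (d * a * c)%:R).
pose G d b a j k u : R := (d * a ^ 2)%:R^-1 * (Num.max 1 `|j%:~R|)^-1 *
   (Num.max 1 `|X u - z d b a j k|)^-1.
have mx0 (x : R) : 0 < Num.max 1 x by rewrite (@lt_le_trans _ _ 1)// le_max lexx.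
have G0 d b a j k u : 0 <= G d b a j k u.
  by rewrite /G !mulr_ge0// ?invr_ge0// ltW.
(* Each u is charged with all tuples of parameters, not only its own. The terms are nonnegative, and
   the sum over u can now be moved inside. *)
pose E u := \sum_(d <- divisors q1) \sum_(b <- divisors q1) \sum_(a <- iota 1 Q)
   \sum_(j <- zrange B) \sum_(k <- zrange (4 * (d * a))) G d b a j k u.
have FE u : u \in V -> q1%:R / ((q2 u)%:R * (q3 u)%:R) / J u / w u <= E u.
  move=> uV; have [d [a [b [c [j [[e1 e2 e3 bc cm] [/andP[q20 q2Q] q30 jJ jB mq]]]]]]] := data u uV.
  have dac : (0 < d)%N /\ (0 < a)%N /\ (0 < c)%N by move: q20; rewrite e2 !muln_gt0 => /andP[/andP[-> ->] ->].
  case: dac => d0 [a0 c0].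
  have b0 : (0 < b)%N by move: q30; rewrite e3 !muln_gt0 => /andP[/andP[_ _] ->].
  have cE : (q1 %/ (d * b))%N = c by rewrite e1 mulKn// muln_gt0 d0.
  have [k [kA mk]] : exists k : int, (`|k| <= 4 * (d * a))%N /\ m u = m0 (b, c, j + a%:Z * mu, (d * a)%N) + c%:Z * k.
    by apply: (hm0 (b, c, j + a%:Z * mu, (d * a)%N)) => //; rewrite -e2.
  apply: (@le_trans _ _ (G d b a j k u)).
    rewrite /G /z cE -mk -e2 e1 e2 e3.
    have -> : (d * b * c)%:R / ((d * a * c)%:R * (d * a * b)%:R) = (d * a ^ 2)%:R^-1 :> R.
      by rewrite !natrM ?natrX; field; rewrite !pnatr_eq0 -!lt0n d0 a0 b0 c0.
    apply: ler_pM; rewrite ?invr_ge0 ?mulr_ge0 ?invr_ge0//.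
    - by rewrite (le_trans _ jJ)// ltW.
    - by rewrite (le_trans _ (hw u uV))// ltW.
    - by rewrite ler_wpM2l ?invr_ge0// lef_pV2 ?posrE// (lt_le_trans _ jJ).
    - rewrite lef_pV2 ?posrE//; last by rewrite (lt_le_trans _ (hw u uV)).
      by have := hw u uV; rewrite e2.
  have S5 : G d b a j k u <= \sum_(k <- zrange (4 * (d * a))) G d b a j k u.
    by apply: (le_sum_mem (F := fun k => G d b a j k u)) => //; rewrite mem_zrange.
  apply: (le_trans S5).
  have S4 : \sum_(k <- zrange (4 * (d * a))) G d b a j k u <= \sum_(j <- zrange B) \sum_(k <- zrange (4 * (d * a))) G d b a j k u.
    apply: (le_sum_mem (F := fun j => \sum_(k <- zrange (4 * (d * a))) G d b a j k u)).
      by rewrite mem_zrange.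
    by move=> ?; rewrite sumr_ge0.
  apply: (le_trans S4).
  pose F3 a := \sum_(j <- zrange B) \sum_(k <- zrange (4 * (d * a))) G d b a j k u.
  have S3 : F3 a <= \sum_(a <- iota 1 Q) F3 a.
    apply: (le_sum_mem (F := F3)); last by move=> ?; rewrite sumr_ge0// => ? _; rewrite sumr_ge0.
    rewrite mem_iota a0 add1n ltnS /=; apply: leq_trans q2Q; rewrite e2 mulnAC.
    by rewrite leq_pmull// muln_gt0 d0.
  apply: (le_trans S3).
  pose F2 b := \sum_(a <- iota 1 Q) \sum_(j <- zrange B) \sum_(k <- zrange (4 * (d * a))) G d b a j k u.
  have F20 d' b' : 0 <= \sum_(a <- iota 1 Q) \sum_(j <- zrange B) \sum_(k <- zrange (4 * (d' * a))) G d' b' a j k u.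
    by rewrite !sumr_ge0// => ? _; rewrite !sumr_ge0// => ? _; rewrite !sumr_ge0.
  have S2 : F2 b <= \sum_(b <- divisors q1) F2 b.
    apply: (le_sum_mem (F := F2)); last by move=> ?; exact: F20.
    by rewrite -dvdn_divisors// e1 mulnAC dvdn_mull.
  apply: (le_trans S2).
  pose F1 d := \sum_(b <- divisors q1) \sum_(a <- iota 1 Q) \sum_(j <- zrange B) \sum_(k <- zrange (4 * (d * a))) G d b a j k u.
  apply: (le_sum_mem (F := F1)); last by move=> ?; rewrite sumr_ge0.
  by rewrite -dvdn_divisors// e1 -mulnA dvdn_mulr.
apply: (le_trans (ler_sum _ FE)).
have Gu d b a j k : \sum_(u in V) G d b a j k u <= (d * a ^ 2)%:R^-1 * (Num.max 1 `|j%:~R|)^-1 * (6 * ell).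
  rewrite -mulr_sumr ler_wpM2l ?mulr_ge0 ?invr_ge0 ?(ltW (mx0 _))//.
  (* [xi] extends [X] from [V] to all cells by the left endpoint k, because the distance sum runs
     over all of them. *)
  pose xi (k : nat) : R := if insub k is Some u then if u \in V then X u else k%:R else k%:R.
  apply: (@le_trans _ _ (\sum_(k' < N) (Num.max 1 `|xi k' - z d b a j k|)^-1)).
    rewrite big_mkcond; apply: ler_sum => u _; rewrite /xi.
    by rewrite valK; case: ifP => // _; rewrite invr_ge0 ltW.
  apply: sum_inv_dist => // i iN; rewrite /xi insubT /=.
  by case: ifP => [/hX//|_]; rewrite lexx lerDl ler01.
have Gk d b a j : (0 < d)%N -> (0 < a)%N ->
    \sum_(k <- zrange (4 * (d * a))) \sum_(u in V) G d b a j k u <=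
    54 * ell * a%:R^-1 * (Num.max 1 `|j%:~R|)^-1.
  move=> d0 a0.
  apply: (le_trans (ler_sum _ (fun k _ => Gu d b a j k))).
  rewrite big_const_seq count_predT size_zrange iter_addr_0 -[leLHS]mulr_natl.
  (* There are 8 d a + 1 <= 9 d a values of k, so 1 / (d a^2) becomes 9 / a. With a factor 6 ell
     from u and another from j this makes 324; the sums over a, d and b give the remaining ell^3. *)
  have h : (2 * (4 * (d * a))).+1%:R * (d * a ^ 2)%:R^-1 <= 9 * a%:R^-1 :> R.
    rewrite ler_pdivrMr ?ltr0n ?muln_gt0 ?expn_gt0 ?d0 ?a0//.
    have -> : 9 * a%:R^-1 * (d * a ^ 2)%:R = (9 * (d * a))%:R :> R.
      by rewrite !natrM ?natrX; field; rewrite pnatr_eq0 -lt0n.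
    rewrite ler_nat. have : (0 < d * a)%N by rewrite muln_gt0 d0. lia.
  have := ler_wpM2r (_ : 0 <= (Num.max 1 `|j%:~R|)^-1 * (6 * ell)) h.
  rewrite !mulrA; move=> H; apply: le_trans (H _) _; last by lra.
  by rewrite mulr_ge0 ?invr_ge0 ?(ltW (mx0 _))// ltW.
have Gj d b a : (0 < d)%N -> (0 < a)%N ->
    \sum_(j <- zrange B) \sum_(k <- zrange (4 * (d * a))) \sum_(u in V) G d b a j k u <=
    324 * ell ^+ 2 * a%:R^-1.
  move=> d0 a0; apply: (le_trans (ler_sum _ (fun j _ => Gk d b a j d0 a0))).
  rewrite -mulr_sumr.
  have h := sum_zrange l1 lB.
  have h2 : 0 <= 54 * ell * a%:R^-1 by rewrite !mulr_ge0 ?invr_ge0// ltW.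
  by have := ler_wpM2l h2 h; rewrite expr2; lra.
have Ga d b : (0 < d)%N ->
    \sum_(a <- iota 1 Q) \sum_(j <- zrange B) \sum_(k <- zrange (4 * (d * a))) \sum_(u in V) G d b a j k u <=
    324 * ell ^+ 3.
  move=> d0; apply: (@le_trans _ _ (\sum_(a <- iota 1 Q) 324 * ell ^+ 2 * a%:R^-1)).
    rewrite big_seq [leRHS]big_seq; apply: ler_sum => a.
    by rewrite mem_iota => /andP[a0 _]; exact: Gj.
  rewrite -mulr_sumr -[iota 1 Q]/(iota (1 + 0)%N Q) iotaDl big_map.
  have -> : iota 0 Q = index_iota 0 Q by rewrite /index_iota subn0.
  rewrite big_mkord [in leRHS]exprSr mulrA.
  exact: (ler_wpM2l (mulr_ge0 (ler0n R 324) (exprn_ge0 2 (ltW ell0))) lQ).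
rewrite /E exchange_big /=.
apply: (@le_trans _ _ (\sum_(d <- divisors q1) \sum_(b <- divisors q1) 324 * ell ^+ 3)).
  rewrite big_seq [leRHS]big_seq; apply: ler_sum => d dq.
  have d0 : (0 < d)%N.
    by move: dq; rewrite -dvdn_divisors// => /dvdn_gt0; apply.
  rewrite exchange_big /=; apply: ler_sum => b _.
  apply: le_trans (Ga d b d0).
  rewrite exchange_big /=; apply: ler_sum => a _.
  rewrite exchange_big /=; apply: ler_sum => j _.
  by rewrite exchange_big.
rewrite !big_const_seq !count_predT !iter_addr_0 -mulrnA -[leLHS]mulr_natl natrM.
have s0 : 0 <= (size (divisors q1))%:R :> R by [].
have : (size (divisors q1))%:R * (size (divisors q1))%:R <= ell * ell by apply: ler_pM.
have e3 : 0 <= 324 * ell ^+ 3 := mulr_ge0 (ler0n R 324) (exprn_ge0 3 (ltW ell0)).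
have -> : ell ^+ 5 = ell ^+ 3 * (ell * ell) by ring.
by move=> /(ler_wpM2r e3); lra.
Qed.

(** * Denominators and weights of a triangle *)

(** With g the gcd of q1 = g b and q2 = g a, the first two fractions add up to n / (g a b), where n
    = a1 a + a2 b is prime to a and to b. Hence a b survives in the third denominator and only a
    part c of g can cancel; d is what remains of g. As c divides n, it is prime to b. *)
Lemma triangle_denominators (q1 q2 q3 : nat) (a1 a2 a3 : int) :
  (0 < q1)%N -> (0 < q2)%N -> (0 < q3)%N ->
  coprimez a1 q1 -> coprimez a2 q2 -> coprimez a3 q3 ->
  a1 * (q2 * q3)%N%:Z + a2 * (q1 * q3)%N%:Z + a3 * (q1 * q2)%N%:Z = 0 ->
  exists d a b c : nat, [/\ q1 = (d * b * c)%N, q2 = (d * a * c)%N,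
    q3 = (d * a * b)%N & coprime b c].
Proof.
move=> q10 q20 q30 c1 c2 c3 E.
pose g := gcdn q1 q2; pose b := (q1 %/ g)%N; pose a := (q2 %/ g)%N.
have g0 : (0 < g)%N by rewrite gcdn_gt0 q10.
have q1E : q1 = (g * b)%N by rewrite mulnC divnK// dvdn_gcdl.
have q2E : q2 = (g * a)%N by rewrite mulnC divnK// dvdn_gcdr.
have b0 : (0 < b)%N by move: q10; rewrite q1E muln_gt0 => /andP[].
have a0 : (0 < a)%N by move: q20; rewrite q2E muln_gt0 => /andP[].
have ab : coprime b a.
  have : (g * gcdn b a == g * 1)%N by rewrite muln_gcdr -q1E -q2E muln1.
  by rewrite eqn_pmul2l.
pose n := a1 * a%:Z + a2 * b%:Z.
have nE : n * q3%:Z = - (a3 * g%:Z * a%:Z * b%:Z).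
  have gz : g%:Z != 0 by rewrite eqz_nat -lt0n.
  apply: (mulfI gz); move: E; rewrite q1E q2E !PoszM /n => E.
  apply/eqP; rewrite -subr_eq0; apply/eqP.
  rewrite -[RHS]E; ring.
have can : coprimez a%:Z n.
  rewrite /coprimez /n gcdzMDl -/(coprimez _ _) coprimezMr.
  rewrite q2E PoszM coprimezMr in c2; case/andP: c2 => _ c2.
  by rewrite coprimez_sym c2 /= coprimezE /= coprime_sym.
have cbn : coprimez b%:Z n.
  rewrite /coprimez /n addrC gcdzMDl -/(coprimez _ _) coprimezMr.
  rewrite q1E PoszM coprimezMr in c1; case/andP: c1 => _ c1.
  by rewrite coprimez_sym c1 /= coprimezE.
have abq3 : (a * b %| q3)%N.
  have : ((a * b)%N %| n * q3%:Z)%Z.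
    rewrite nE rpredN PoszM -mulrA; exact: dvdz_mull.
  by rewrite Gauss_dvdzr// PoszM coprimezMl can cbn.
pose d := (q3 %/ (a * b))%N.
have q3E : q3 = (a * b * d)%N by rewrite mulnC divnK.
have d0 : (0 < d)%N by move: q30; rewrite q3E muln_gt0 => /andP[].
have ndE : n * d%:Z = - (a3 * g%:Z).
  have abz : a%:Z * b%:Z != 0 by rewrite mulf_neq0// eqz_nat -lt0n.
  apply: (mulfI abz); move: nE; rewrite q3E !PoszM => nE.
  by apply/eqP; rewrite -subr_eq0 -(subrr (n * (a%:Z * b%:Z * d%:Z))) {2}nE; apply/eqP; ring.
have dg : (d %| g)%N.
  have : (d%:Z %| a3 * g%:Z)%Z by have := dvdz_mull n (dvdzz d%:Z); rewrite ndE rpredN.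
  rewrite Gauss_dvdzr// coprimez_sym.
  by rewrite q3E PoszM coprimezMr in c3; case/andP: c3.
pose c := (g %/ d)%N.
have gE : g = (d * c)%N by rewrite mulnC divnK.
have ncE : n = - (a3 * c%:Z).
  have dz : d%:Z != 0 by rewrite eqz_nat -lt0n.
  by apply: (mulfI dz); rewrite mulrC ndE gE PoszM; ring.
exists d, a, b, c; split.
- by rewrite q1E gE mulnAC.
- by rewrite q2E gE mulnAC.
- by rewrite q3E mulnC mulnA.
- have := cbn; rewrite ncE coprimezN coprimezMr => /andP[_].
  by rewrite coprimezE.
Qed.

(** After cubing, this is the weak mean inequality y1 y2 y3 <= (y1 + y2 + y3)^3 for y_i = k_i
    w_i. *)
Lemma geometric_mean_le (R : realType) (k1 k2 k3 w1 w2 w3 L : R) :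
  0 < k1 -> 0 < k2 -> 0 < k3 -> 0 < w1 -> 0 < w2 -> 0 < w3 -> 0 < L ->
  (k1 * k2 * k3) ^+ 2 <= L ^+ 3 * (w1 * w2 * w3) ->
  k1 * k2 * k3 <= L * (k1 * w1 + k2 * w2 + k3 * w3).
Proof.
move=> k10 k20 k30 w10 w20 w30 L0 h.
have y1 : 0 < k1 * w1 by rewrite mulr_gt0.
have y2 : 0 < k2 * w2 by rewrite mulr_gt0.
have y3 : 0 < k3 * w3 by rewrite mulr_gt0.
have K0 : 0 < k1 * k2 * k3 by rewrite !mulr_gt0.
rewrite -(@ler_pXn2r _ 3) ?nnegrE//; [|exact: ltW|]; last first.
  by rewrite mulr_ge0 ?addr_ge0// ltW.
rewrite [leRHS]exprMn.
have s3 : (k1 * w1) * (k2 * w2) * (k3 * w3) <= (k1 * w1 + k2 * w2 + k3 * w3) ^+ 3.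
  move: (k1 * w1) (k2 * w2) (k3 * w3) y1 y2 y3 => a b c a0 b0 c0.
  have -> : (a + b + c) ^+ 3 = a * b * c + (a ^+ 3 + b ^+ 3 + c ^+ 3 + 3 * (a ^+ 2 * b) + 3 * (a ^+ 2 * c) + 3 * (b ^+ 2 * a) + 3 * (b ^+ 2 * c) + 3 * (c ^+ 2 * a) + 3 * (c ^+ 2 * b) + 5 * (a * b * c)) by ring.
  by rewrite lerDl !addr_ge0// !mulr_ge0// ?exprn_ge0// ltW.
apply: (@le_trans _ _ (L ^+ 3 * ((k1 * w1) * (k2 * w2) * (k3 * w3)))); last first.
  by rewrite ler_wpM2l// exprn_ge0// ltW.
have -> : L ^+ 3 * ((k1 * w1) * (k2 * w2) * (k3 * w3)) = (k1 * k2 * k3) * (L ^+ 3 * (w1 * w2 * w3)) by ring.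
by rewrite exprS ler_pM2l.
Qed.

(** After division by w1 / N^3 and squaring, min (w2, w3)^2 <= w2 w3 <= (w2 w3)^3 bounds the left
    side by ((q1 w1) (q2 w2) (q3 w3))^3 w1, which is at most P^10. *)
Lemma defect_le (R : realType) (N : nat) (q1 q2 q3 w1 w2 w3 P : R) :
  (0 < N)%N -> 1 <= q1 -> 1 <= q2 -> 1 <= q3 -> 1 <= w1 -> 1 <= w2 -> 1 <= w3 ->
  q1 * w1 <= P -> q2 * w2 <= P -> q3 * w3 <= P ->
  (Num.sqrt (q1 * q2 * q3) * w1 / N%:R) ^+ 3 * Num.min w2 w3 <= P ^+ 5 / N%:R ^+ 3 * w1.
Proof.
move=> N0 q11 q21 q31 w11 w21 w31 p1 p2 p3.
have N0R : 0 < N%:R :> R by rewrite ltr0n.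
have Q0 : 0 <= q1 * q2 * q3 by rewrite !mulr_ge0//; lra.
have P0 : 0 < P by nra.
set s := Num.sqrt _.
have s0 : 0 <= s by rewrite sqrtr_ge0.
have ss : s ^+ 2 = q1 * q2 * q3 by rewrite sqr_sqrtr.
have m0 : 0 <= Num.min w2 w3 by rewrite le_min; apply/andP; split; lra.
have mm : Num.min w2 w3 ^+ 2 <= w2 * w3.
  rewrite expr2; apply: ler_pM => //; first by rewrite ge_min lexx.
  by rewrite ge_min lexx orbT.
have -> : (s * w1 / N%:R) ^+ 3 * Num.min w2 w3 = (s ^+ 3 * w1 ^+ 2 * Num.min w2 w3 / N%:R ^+ 3) * w1.
  by field; rewrite gt_eqF.
rewrite ler_pM2r ?(lt_le_trans _ w11)// ler_pM2r ?invr_gt0 ?exprn_gt0//.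
rewrite -(@ler_pXn2r _ 2) ?nnegrE//; last 2 first.
- by rewrite !mulr_ge0 ?exprn_ge0//; lra.
- by rewrite exprn_ge0// ltW.
have -> : (s ^+ 3 * w1 ^+ 2 * Num.min w2 w3) ^+ 2 = (s ^+ 2) ^+ 3 * w1 ^+ 4 * Num.min w2 w3 ^+ 2 by ring.
rewrite ss.
have w23 : 1 <= w2 * w3 by nra.
apply: (@le_trans _ _ ((q1 * q2 * q3) ^+ 3 * w1 ^+ 4 * (w2 * w3) ^+ 3)).
  rewrite ler_wpM2l//; first by rewrite mulr_ge0 ?exprn_ge0//; lra.
  by apply: (le_trans mm); rewrite -[leLHS]expr1; apply: ler_weXn2l.
have -> : (q1 * q2 * q3) ^+ 3 * w1 ^+ 4 * (w2 * w3) ^+ 3 = ((q1 * w1) * (q2 * w2) * (q3 * w3)) ^+ 3 * w1 by ring.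
have -> : (P ^+ 5) ^+ 2 = (P * P * P) ^+ 3 * P by ring.
apply: ler_pM; rewrite ?exprn_ge0 ?mulr_ge0//; try lra.
- rewrite ler_pXn2r// ?nnegrE; last 2 first.
  + by rewrite !mulr_ge0//; lra.
  + by rewrite !mulr_ge0// ltW.
  by do 2 (apply: ler_pM; rewrite ?mulr_ge0//; try lra).
- by apply: le_trans p1; rewrite ler_peMl//; lra.
Qed.

(** Here k_i stands for |K_i|, and q_i w_i is the bound L N^2 / k_i^2 of [weyl_inverse]. By
    [geometric_mean_le] only the product of the three weights matters. It is 1 / (q1 q2 q3 J^3 M),
    with M the product of the three minima, and J^3 M exceeds w1 w2 w3 by at most the factor H. *)
Lemma triangle_product_le (R : realType) (N : nat)
    (q1 q2 q3 w1 w2 w3 P k1 k2 k3 L J : R) :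
  (0 < N)%N -> 1 <= q1 -> 1 <= q2 -> 1 <= q3 -> 1 <= w1 -> 1 <= w2 -> 1 <= w3 ->
  q1 * w1 <= P -> q2 * w2 <= P -> q3 * w3 <= P ->
  0 < k1 -> 0 < k2 -> 0 < k3 -> 0 < L ->
  k1 ^+ 2 * (q1 * w1) = L * N%:R ^+ 2 -> k2 ^+ 2 * (q2 * w2) = L * N%:R ^+ 2 ->
  k3 ^+ 2 * (q3 * w3) = L * N%:R ^+ 2 ->
  J = 1 + Num.sqrt (q1 * q2 * q3) * (w1 + w2 + w3) / N%:R ->
  k1 * k2 * k3 <= L * N%:R ^+ 2 * (16 * (1 + 3 * (P ^+ 5 / N%:R ^+ 3))) *
    (k1 * (q1 / (q2 * q3) / J / Num.min w2 w3) +
     k2 * (q2 / (q3 * q1) / J / Num.min w3 w1) +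
     k3 * (q3 / (q1 * q2) / J / Num.min w1 w2)).
Proof.
move=> N0 q11 q21 q31 w11 w21 w31 p1 p2 p3 k10 k20 k30 L0 e1 e2 e3 JE0.
have N0R : 0 < N%:R :> R by rewrite ltr0n.
have q10 : 0 < q1 by lra.
have q20 : 0 < q2 by lra.
have q30 : 0 < q3 by lra.
have w10 : 0 < w1 by lra.
have w20 : 0 < w2 by lra.
have w30 : 0 < w3 by lra.
have P0 : 0 < P by nra.
set s := Num.sqrt (q1 * q2 * q3) in JE0 *.
have s0 : 0 <= s by rewrite sqrtr_ge0.
set E := P ^+ 5 / N%:R ^+ 3.
have E0 : 0 <= E by rewrite divr_ge0 ?exprn_ge0// ltW.
set H := 16 * (1 + 3 * E).
have H1 : 1 <= H by rewrite /H; lra.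
have J0 : 0 < J by rewrite JE0 ltr_pwDl// !mulr_ge0 ?invr_ge0//; lra.
have m12 : 0 < Num.min w1 w2 by rewrite lt_min w10.
have m23 : 0 < Num.min w2 w3 by rewrite lt_min w20.
have m31 : 0 < Num.min w3 w1 by rewrite lt_min w30.
have minl (a b : R) : Num.min a b <= a by rewrite ge_min lexx.
have minr (a b : R) : Num.min a b <= b by rewrite ge_min lexx orbT.
set M := Num.min w1 w2 * Num.min w2 w3 * Num.min w3 w1.
have M0 : 0 < M by rewrite !mulr_gt0.
have M1 : M <= w1 * w2 * w3.
  rewrite /M; apply: ler_pM => //; rewrite ?mulr_ge0 ?(ltW m12) ?(ltW m23) ?(ltW m31)//.
  by apply: ler_pM; rewrite ?(ltW m12) ?(ltW m23)//.
pose j1 := s * w1 / N%:R; pose j2 := s * w2 / N%:R; pose j3 := s * w3 / N%:R.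
have j10 : 0 <= j1 by rewrite !mulr_ge0 ?invr_ge0// ltW.
have j20 : 0 <= j2 by rewrite !mulr_ge0 ?invr_ge0// ltW.
have j30 : 0 <= j3 by rewrite !mulr_ge0 ?invr_ge0// ltW.
have JE : J = 1 + j1 + j2 + j3 by rewrite JE0 /j1 /j2 /j3; field; rewrite gt_eqF.
(* The inequality (a + b)^3 <= 4 (a^3 + b^3), applied on two levels, gives 16. *)
have J3 : J ^+ 3 <= 16 * (1 + j1 ^+ 3 + j2 ^+ 3 + j3 ^+ 3).
  rewrite JE; have sq (a b : R) : 0 <= a -> 0 <= b -> (a + b) ^+ 3 <= 4 * (a ^+ 3 + b ^+ 3).
    move=> a0 b0; rewrite -subr_ge0.
    have -> : 4 * (a ^+ 3 + b ^+ 3) - (a + b) ^+ 3 = 3 * ((a + b) * (a - b) ^+ 2) by ring.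
    apply: mulr_ge0 => //; apply: mulr_ge0; [exact: addr_ge0 | exact: sqr_ge0].
  have := sq _ _ (addr_ge0 ler01 j10) (addr_ge0 j20 j30).
  have := sq _ _ ler01 j10; have := sq _ _ j20 j30.
  by rewrite expr1n !addrA; lra.
have split3 (a b c : R) : 0 <= a -> 0 <= b -> 0 <= c -> forall a' b' : R, a <= a' -> b <= b' ->
    a * b * c <= c * (a' * b').
  by move=> a0 b0 c0 a' b' aa bb; rewrite mulrC ler_wpM2l// ler_pM.
(* The two other minima are bounded by w2 and w3, never by w1, because [defect_le] supplies w1 as
   the missing third factor. *)
have M23 : M <= Num.min w2 w3 * (w2 * w3).
  by rewrite /M mulrAC; apply: split3; rewrite ?minl ?minr ?ltW.
have M31 : M <= Num.min w3 w1 * (w3 * w1).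
  by rewrite /M [X in X * _]mulrC; apply: split3; rewrite ?minl ?minr ?ltW.
have M12 : M <= Num.min w1 w2 * (w1 * w2).
  by rewrite /M -mulrA mulrC [X in X * _]mulrC; apply: split3; rewrite ?minl ?minr ?ltW.
have d1 : j1 ^+ 3 * M <= E * (w1 * w2 * w3).
  have h := @defect_le R N q1 q2 q3 w1 w2 w3 P N0 q11 q21 q31 w11 w21 w31 p1 p2 p3.
  have := ler_wpM2r (ltW (mulr_gt0 w20 w30)) h; rewrite -/s -/j1 -/E.
  by have := ler_wpM2l (exprn_ge0 3 j10) M23; lra.
have d2 : j2 ^+ 3 * M <= E * (w1 * w2 * w3).
  have h := @defect_le R N q2 q3 q1 w2 w3 w1 P N0 q21 q31 q11 w21 w31 w11 p2 p3 p1.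
  have qq : q2 * q3 * q1 = q1 * q2 * q3 by ring.
  have := ler_wpM2r (ltW (mulr_gt0 w30 w10)) h; rewrite qq -/s -/j2 -/E.
  by have := ler_wpM2l (exprn_ge0 3 j20) M31; lra.
have d3 : j3 ^+ 3 * M <= E * (w1 * w2 * w3).
  have h := @defect_le R N q3 q1 q2 w3 w1 w2 P N0 q31 q11 q21 w31 w11 w21 p3 p1 p2.
  have qq : q3 * q1 * q2 = q1 * q2 * q3 by ring.
  have := ler_wpM2r (ltW (mulr_gt0 w10 w20)) h; rewrite qq -/s -/j3 -/E.
  by have := ler_wpM2l (exprn_ge0 3 j30) M12; lra.
have JM : J ^+ 3 * M <= H * (w1 * w2 * w3).
  by have := ler_wpM2r (ltW M0) J3; rewrite /H; lra.
have LN0 : 0 < L * N%:R ^+ 2 by rewrite mulr_gt0// exprn_gt0.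
apply: geometric_mean_le => //; rewrite ?divr_gt0 ?mulr_gt0 ?invr_gt0//; first by lra.
have -> : q1 / (q2 * q3) / J / Num.min w2 w3 * (q2 / (q3 * q1) / J / Num.min w3 w1) *
   (q3 / (q1 * q2) / J / Num.min w1 w2) = (q1 * q2 * q3 * (J ^+ 3 * M))^-1.
  by rewrite /M; field; rewrite !gt_eqF.
rewrite ler_pdivlMr ?mulr_gt0 ?exprn_gt0//.
have W0 : 0 < w1 * w2 * w3 by rewrite !mulr_gt0.
apply: (@le_trans _ _ ((k1 * k2 * k3) ^+ 2 * (q1 * q2 * q3 * (H * (w1 * w2 * w3))))).
  by rewrite ler_wpM2l ?sqr_ge0// ler_pM2l ?mulr_gt0.
have -> : (k1 * k2 * k3) ^+ 2 * (q1 * q2 * q3 * (H * (w1 * w2 * w3))) =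
  H * ((k1 ^+ 2 * (q1 * w1)) * (k2 ^+ 2 * (q2 * w2)) * (k3 ^+ 2 * (q3 * w3))) by ring.
rewrite e1 e2 e3.
have -> : (L * N%:R ^+ 2 * H) ^+ 3 = H ^+ 3 * (L * N%:R ^+ 2 * (L * N%:R ^+ 2) * (L * N%:R ^+ 2)) by ring.
apply: ler_wpM2r; first by rewrite !mulr_ge0 ?(ltW LN0)// ltW.
by rewrite -[leLHS]expr1; apply: ler_weXn2l.
Qed.

(** Both sums of fractions are cleared of denominators and become integers. The one for t is smaller
    than 1 in modulus, hence 0, and this shapes the denominators. For x the common denominator is
    only a b c d = a q1 = b q2 = c q3, and the integer is bounded by the accumulated errors. *)
Lemma triangle_relations (R : realType) (N : nat) (q1 q2 q3 : nat)
    (a1 a2 a3 m1 m2 m3 : int) (x1 x2 x3 t1 t2 t3 p1 p2 p3 P : R) :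
  (0 < N)%N -> 3 * P ^+ 3 < N%:R ^+ 2 ->
  x1 + x2 + x3 = 0 -> t1 + t2 + t3 = 0 ->
  (0 < q1)%N -> (0 < q2)%N -> (0 < q3)%N ->
  coprimez a1 q1 -> coprimez a2 q2 -> coprimez a3 q3 ->
  q1%:R <= p1 -> q2%:R <= p2 -> q3%:R <= p3 -> p1 <= P -> p2 <= P -> p3 <= P ->
  `|q1%:R * x1 - m1%:~R| <= p1 / N%:R -> `|q2%:R * x2 - m2%:~R| <= p2 / N%:R ->
  `|q3%:R * x3 - m3%:~R| <= p3 / N%:R ->
  `|q1%:R * t1 - a1%:~R| <= p1 / N%:R ^+ 2 -> `|q2%:R * t2 - a2%:~R| <= p2 / N%:R ^+ 2 ->
  `|q3%:R * t3 - a3%:~R| <= p3 / N%:R ^+ 2 ->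
  exists d a b c : nat, [/\ q1 = (d * b * c)%N, q2 = (d * a * c)%N,
    q3 = (d * a * b)%N, coprime b c &
    `|(a%:Z * m1 + b%:Z * m2 + c%:Z * m3)%:~R| <=
     Num.sqrt (q1%:R * q2%:R * q3%:R) * (p1 / q1%:R + p2 / q2%:R + p3 / q3%:R) / N%:R :> R].
Proof.
move=> N0 PN xs ts q10 q20 q30 c1 c2 c3 qp1 qp2 qp3 pP1 pP2 pP3 hx1 hx2 hx3 ht1 ht2 ht3.
have N0R : 0 < N%:R :> R by rewrite ltr0n.
have q10R : 0 < q1%:R :> R by rewrite ltr0n.
have q20R : 0 < q2%:R :> R by rewrite ltr0n.
have q30R : 0 < q3%:R :> R by rewrite ltr0n.
have p10 : 0 < p1 by exact: lt_le_trans qp1.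
have p20 : 0 < p2 by exact: lt_le_trans qp2.
have p30 : 0 < p3 by exact: lt_le_trans qp3.
have qP1 := le_trans qp1 pP1; have qP2 := le_trans qp2 pP2; have qP3 := le_trans qp3 pP3.
have prod3 (u v w : R) : 0 <= u -> 0 <= v -> 0 <= w -> u <= P -> v <= P -> w <= P -> u * v * w <= P ^+ 3.
  move=> u0 v0 w0 uP vP wP.
  have -> : P ^+ 3 = P * P * P by ring.
  by apply: ler_pM; rewrite ?mulr_ge0//; apply: ler_pM.
have E : a1 * (q2 * q3)%N%:Z + a2 * (q1 * q3)%N%:Z + a3 * (q1 * q2)%N%:Z = 0.
  set S := (LHS); apply/eqP; apply: contraT => S0.
  have S1 : 1 <= `|S%:~R| :> R by rewrite -intr_norm ler1z -gtz0_ge1 normr_gt0.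
  have SE : S%:~R = - ((q1%:R * t1 - a1%:~R) * (q2%:R * q3%:R) + (q2%:R * t2 - a2%:~R) * (q1%:R * q3%:R)
      + (q3%:R * t3 - a3%:~R) * (q1%:R * q2%:R)) :> R.
    have t3E : t3 = - t1 - t2 by lra.
    by rewrite /S !rmorphD !rmorphM /= t3E; ring.
  have : `|S%:~R| <= 3 * P ^+ 3 / N%:R ^+ 2 :> R.
    rewrite SE normrN.
    have term (u p q q' : R) : 0 < q -> 0 < q' -> q <= P -> q' <= P -> 0 < p -> p <= P ->
       `|u| <= p / N%:R ^+ 2 -> `|u * (q * q')| <= P ^+ 3 / N%:R ^+ 2.
      move=> q0 q0' qP qP' p0 pP hu.
      have qq0 : 0 <= q * q' by rewrite mulr_ge0// ltW.
      rewrite normrM (ger0_norm qq0).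
      apply: (@le_trans _ _ (p / N%:R ^+ 2 * (q * q'))); first by rewrite ler_wpM2r.
      rewrite mulrAC ler_wpM2r ?invr_ge0 ?exprn_ge0// mulrA.
      by apply: prod3 => //; exact: ltW.
    apply: (le_trans (ler_normD _ _)).
    have -> : 3 * P ^+ 3 / N%:R ^+ 2 = P ^+ 3 / N%:R ^+ 2 + P ^+ 3 / N%:R ^+ 2 + P ^+ 3 / N%:R ^+ 2.
      by field; rewrite gt_eqF.
    apply: lerD; first apply: (le_trans (ler_normD _ _)); first apply: lerD.
    - exact: (@term _ p1).
    - exact: (@term _ p2).
    - exact: (@term _ p3).
  have : 3 * P ^+ 3 / N%:R ^+ 2 < 1 by rewrite ltr_pdivrMr ?exprn_gt0// mul1r.
  by move=> *; exfalso; lra.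
have [d [a [b [c [e1 e2 e3 bc]]]]] := triangle_denominators q10 q20 q30 c1 c2 c3 E.
exists d, a, b, c; split=> //.
have d1 : 1 <= d%:R :> R by rewrite ler1n; move: q10; rewrite e1; case: (d).
have D0 : 0 <= a%:R * b%:R * c%:R * d%:R :> R by rewrite !mulr_ge0.
(* Indeed q1 q2 q3 = d (a b c d)^2. *)
have Ds : a%:R * b%:R * c%:R * d%:R <= Num.sqrt (q1%:R * q2%:R * q3%:R) :> R.
  rewrite -(@ler_pXn2r _ 2) ?nnegrE ?sqrtr_ge0// sqr_sqrtr ?mulr_ge0//.
  rewrite e1 e2 e3 !natrM.
  have -> : d%:R * b%:R * c%:R * (d%:R * a%:R * c%:R) * (d%:R * a%:R * b%:R) = d%:R * (a%:R * b%:R * c%:R * d%:R) ^+ 2 :> R by ring.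
  by rewrite ler_peMl// sqr_ge0.
have x3E : x3 = - x1 - x2 by lra.
have -> : (a%:Z * m1 + b%:Z * m2 + c%:Z * m3)%:~R =
   - (a%:R * (q1%:R * x1 - m1%:~R) + b%:R * (q2%:R * x2 - m2%:~R) + c%:R * (q3%:R * x3 - m3%:~R)) :> R.
  by rewrite !rmorphD !rmorphM /= x3E e1 e2 e3 !natrM; ring.
rewrite normrN.
apply: (@le_trans _ _ (a%:R * (p1 / N%:R) + b%:R * (p2 / N%:R) + c%:R * (p3 / N%:R))).
  apply: (le_trans (ler_normD _ _)); apply: lerD.
    apply: (le_trans (ler_normD _ _)); apply: lerD.
      by rewrite normrM ger0_norm// ler_wpM2l.
    by rewrite normrM ger0_norm// ler_wpM2l.
  by rewrite normrM ger0_norm// ler_wpM2l.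
have -> : a%:R * (p1 / N%:R) + b%:R * (p2 / N%:R) + c%:R * (p3 / N%:R) =
  a%:R * b%:R * c%:R * d%:R * (p1 / q1%:R + p2 / q2%:R + p3 / q3%:R) / N%:R.
  have := q10R; have := q20R; rewrite e1 e2 e3 !natrM => h2 h1.
  have [d0 a0 b0 c0] : [/\ d%:R != 0 :> R, a%:R != 0 :> R, b%:R != 0 :> R & c%:R != 0 :> R].
    move: (gt_eqF h1) (gt_eqF h2); rewrite !mulf_eq0 => /negbT + /negbT.
    by rewrite !negb_or => /andP[/andP[-> ->] ->] /andP[/andP[_ ->] _].
  by field; rewrite d0 a0 b0 c0 gt_eqF.
rewrite ler_wpM2r ?invr_ge0// ler_wpM2r//.
by rewrite !addr_ge0// divr_ge0// ltW.
Qed.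

Lemma normc_weyl_kernelN (R : realType) (N : nat) (x t : R) :
  normc (weyl_kernel N (- x) (- t)) = normc (weyl_kernel N x t).
Proof.
rewrite -[RHS]normcJ_eq /weyl_kernel rmorph_sum /=; congr normc; apply: eq_bigr => i _.
by rewrite -[RHS]eN; congr e; ring.
Qed.

Lemma weyl_kernel00 (R : realType) (N : nat) : normc (weyl_kernel N (0 : R) 0) = N%:R.
Proof.
rewrite /weyl_kernel; under eq_bigr => i _ do rewrite !mulr0 addr0 e0.
by rewrite sumr_const card_ord -(rmorph_nat (real_complex R)) normc_real ger0_norm.
Qed.

(** * The energy inequality *)

Lemma sqr_sum_le (R : realFieldType) (I : Type) (r : seq I) (A : pred I) (F : I -> R) :
  (\sum_(i <- r | A i) F i) ^+ 2 <= (\sum_(i <- r | A i) 1) * \sum_(i <- r | A i) F i ^+ 2.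
Proof.
set S := \sum_(i <- r | A i) F i; set n := \sum_(i <- r | A i) 1; set S2 := \sum_(i <- r | A i) _.
have : 0 <= \sum_(i <- r | A i) \sum_(j <- r | A j) (F i - F j) ^+ 2.
  by apply: sumr_ge0 => i _; apply: sumr_ge0 => j _; exact: sqr_ge0.
have -> : \sum_(i <- r | A i) \sum_(j <- r | A j) (F i - F j) ^+ 2 =
  \sum_(i <- r | A i) (F i ^+ 2 * n + (F i * (- 2 * S) + 1 * S2)).
  apply: eq_bigr => i _; rewrite /n /S /S2 !mulr_sumr -!big_split /=.
  by apply: eq_bigr => j _; ring.
by rewrite !big_split /= -!mulr_suml -/S -/n -/S2; lra.
Qed.

(** The bound on [\sum_u W r s u] is multiplied by [f r s], so that it is asked on edges only. The
    constant 12 comes from two factors M / 2, in the lower bounds for the triangle sum and for [Y],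
    and from the three edges of a triangle. *)
Lemma triangle_energy (R : realFieldType) (T : finType) (V : {set T}) (f : T -> T -> R)
    (W : T -> T -> T -> R) (M Lam B : R) :
  0 < M -> 0 <= Lam -> 0 <= B -> (forall r s, 0 <= f r s) -> (forall r s, f r s = f s r) ->
  (forall r s, r \notin V -> f r s = 0) ->
  (forall r s u, f r s * f s u * f u r <=
     Lam * (f r s * W r s u + f s u * W s u r + f u r * W u r s)) ->
  (forall r s, f r s * \sum_u W r s u <= B * f r s) ->
  (forall v : T -> R, (forall k, 0 <= v k) ->
    M / 2 * (\sum_(k in V) v k) ^+ 2 <= \sum_r \sum_s v r * v s * f r s) ->
  #|V|%:R * M ^+ 2 <= 12 * Lam * B.
Proof.
move=> M0 Lam0 B0 f0 fsym fV triangle sumW dualf.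
pose Y := \sum_r \sum_s f r s.
pose d r := \sum_s f r s.
have Y0 : 0 <= Y by apply: sumr_ge0 => r _; apply: sumr_ge0.
have dV r : \sum_(s in V) f r s = d r.
  rewrite /d [RHS](bigID (mem V)) /= [X in _ + X]big1 ?addr0// => s sV.
  by rewrite fsym fV.
have YV : \sum_(r in V) d r = Y.
  rewrite /Y [RHS](bigID (mem V)) /= [X in _ + X]big1 ?addr0// => r rV.
  by apply: big1 => s _; rewrite fV.
have upper : \sum_r \sum_s \sum_u f r s * f s u * f u r <= 3 * Lam * B * Y.
  apply: (@le_trans _ _ (\sum_r \sum_s \sum_u Lam * (f r s * W r s u + f s u * W s u r + f u r * W u r s))).
    by do 3 (apply: ler_sum => ? _).
  pose g r s u := Lam * (f r s * W r s u).
  have -> : \sum_r \sum_s \sum_u Lam * (f r s * W r s u + f s u * W s u r + f u r * W u r s) =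
     \sum_r \sum_s \sum_u g r s u + \sum_r \sum_s \sum_u g s u r + \sum_r \sum_s \sum_u g u r s.
    rewrite -!big_split /=; apply: eq_bigr => r _; rewrite -!big_split /=; apply: eq_bigr => s _.
    by rewrite -!big_split /=; apply: eq_bigr => u _; rewrite /g; ring.
  have -> : \sum_r \sum_s \sum_u g s u r = \sum_r \sum_s \sum_u g r s u.
    by rewrite exchange_big /=; apply: eq_bigr => s _; rewrite exchange_big.
  have -> : \sum_r \sum_s \sum_u g u r s = \sum_r \sum_s \sum_u g r s u.
    by rewrite [RHS]exchange_big /=; apply: eq_bigr => r _ /=; rewrite [RHS]exchange_big.
  have : \sum_r \sum_s \sum_u g r s u <= Lam * B * Y.
    rewrite /Y mulr_sumr; apply: ler_sum => r _; rewrite mulr_sumr; apply: ler_sum => s _.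
    by rewrite /g -!mulr_sumr -mulrA ler_wpM2l.
  lra.
have lower : M / 2 * \sum_(r in V) d r ^+ 2 <= \sum_r \sum_s \sum_u f r s * f s u * f u r.
  rewrite mulr_sumr big_mkcond; apply: ler_sum => r _; case: ifP => rV; last first.
    by apply: sumr_ge0 => s _; apply: sumr_ge0 => u _; rewrite !mulr_ge0.
  have := dualf (f r) (f0 r); rewrite dV => h; apply: le_trans h _.
  rewrite le_eqVlt; apply/orP; left; apply/eqP.
  by apply: eq_bigr => s _; apply: eq_bigr => u _; rewrite (fsym u r); ring.
have Vone : \sum_(i in V) 1 = #|V|%:R :> R by rewrite sumr_const.
have cs := sqr_sum_le (index_enum T) (mem V) d; rewrite YV Vone in cs.
have Ylow : M / 2 * #|V|%:R ^+ 2 <= Y.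
  have := dualf (fun _ => 1) (fun _ => ler01); rewrite Vone => h; apply: le_trans h _.
  by rewrite /Y; do 2 (apply: ler_sum => ? _); rewrite !mul1r.
have [V0|Vpos] := posnP #|V|.
  by rewrite V0 mul0r !mulr_ge0.
have VR : 0 < #|V|%:R :> R by rewrite ltr0n.
have Ypos : 0 < Y by apply: lt_le_trans Ylow; rewrite mulr_gt0 ?divr_gt0// exprn_gt0.
have M2 : 0 <= M / 2 by rewrite divr_ge0// ltW.
have step : M / 2 * Y <= #|V|%:R * (3 * Lam * B).
  rewrite -(ler_pM2r Ypos).
  have := ler_wpM2l M2 cs.
  have := ler_wpM2l (ltW VR) (le_trans lower upper).
  by rewrite expr2; lra.
have : M / 2 * (M / 2 * #|V|%:R ^+ 2) <= #|V|%:R * (3 * Lam * B).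
  by apply: le_trans step; rewrite ler_wpM2l.
have -> : M / 2 * (M / 2 * #|V|%:R ^+ 2) = #|V|%:R * (#|V|%:R * M ^+ 2 / 4) by field.
by rewrite ler_pM2l//; lra.
Qed.

(** One harmonic number, of index 6 N^3 + 3, serves for every sum: 2N in [weyl_inverse], N for
    positions and denominators, and 2 (3 N^3 + 1) + 1 for the integers j allowed by
    [tri_defect_le]. *)
Lemma cube_bounds (N : nat) : (0 < N)%N -> [/\ (2 * N <= (6 * N ^ 3).+3)%N,
  (N <= (6 * N ^ 3).+3)%N & ((2 * (3 * N ^ 3).+1).+1 <= (6 * N ^ 3).+3)%N].
Proof.
move=> N0; have h3 : (N <= N ^ 3)%N by rewrite -[leqLHS]expn1 leq_pexp2l.
by split; lia.
Qed.

Lemma edge_bounds (R : realType) (N q : nat) (m : int) (y p P : R) :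
  (0 < N)%N -> P <= N%:R -> (0 < q)%N -> q%:R <= p -> p <= P -> `|y| <= 1 ->
  `|q%:R * y - m%:~R| <= p / N%:R ->
  [/\ 1 <= p / q%:R, p / q%:R <= N%:R, (`|m| <= 2 * q)%N & (q <= N)%N].
Proof.
move=> N0 PN q0 qp pP y1 hm.
have N0R : 0 < N%:R :> R by rewrite ltr0n.
have q0R : 0 < q%:R :> R by rewrite ltr0n.
have q1 : 1 <= q%:R :> R by rewrite ler1n.
have pN : p <= N%:R by exact: le_trans pP PN.
split.
- by rewrite ler_pdivlMr ?mul1r.
- by rewrite ler_pdivrMr// (le_trans pN)// ler_peMr// ltW.
- rewrite -(ler_nat R) -[leLHS]/(`|m|%:Z%:~R) abszE intr_norm natrM.
  have h1 : p / N%:R <= 1 by rewrite ler_pdivrMr// mul1r.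
  have h2 : `|q%:R * y| <= q%:R by rewrite normrM ger0_norm// ler_piMr// ltW.
  have h3 : `|m%:~R| <= `|q%:R * y| + `|q%:R * y - m%:~R| :> R.
    by rewrite -{1}[m%:~R](subKr (q%:R * y)) ler_normB.
  lra.
- by rewrite -(ler_nat R) (le_trans qp).
Qed.

(** In units of cells, a neighbour lies within w = p / q of the place predicted by the fraction m /
    q; this is the distance hypothesis of [count_third_vertex]. *)
Lemma scaled_distance (R : realType) (N q : nat) (m : int) (x y p : R) :
  (0 < N)%N -> (0 < q)%N -> `|q%:R * (x - y) - m%:~R| <= p / N%:R ->
  `|N%:R * x - (N%:R * y + N%:R * (m%:~R / q%:R))| <= p / q%:R.
Proof.
move=> N0 q0 hm.
have N0R : 0 < N%:R :> R by rewrite ltr0n.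
have q0R : 0 < q%:R :> R by rewrite ltr0n.
have -> : N%:R * x - (N%:R * y + N%:R * (m%:~R / q%:R)) = N%:R / q%:R * (q%:R * (x - y) - m%:~R).
  by field; rewrite gt_eqF.
have -> : p / q%:R = N%:R / q%:R * (p / N%:R) by field; rewrite !gt_eqF.
by rewrite normrM ger0_norm ?divr_ge0// ler_wpM2l ?divr_ge0.
Qed.

(* An upper bound for the numerator, over the denominator d a b c, of the sum of the
   three x-fractions of a triangle; q_i w_i / N bounds the error |q_i x_i - m_i|. *)
Definition tri_defect (R : realType) (N q1 q2 q3 : nat) (w1 w2 w3 : R) : R :=
  1 + Num.sqrt (q1%:R * q2%:R * q3%:R) * (w1 + w2 + w3) / N%:R.

Lemma tri_defect_cycle (R : realType) (N q1 q2 q3 : nat) (w1 w2 w3 : R) :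
  tri_defect N q2 q3 q1 w2 w3 w1 = tri_defect N q1 q2 q3 w1 w2 w3.
Proof. by rewrite /tri_defect; congr (1 + Num.sqrt _ * _ / _); ring. Qed.

Lemma tri_defect_ge1 (R : realType) (N q1 q2 q3 : nat) (w1 w2 w3 : R) :
  0 <= w1 -> 0 <= w2 -> 0 <= w3 -> 1 <= tri_defect N q1 q2 q3 w1 w2 w3.
Proof.
by move=> *; rewrite /tri_defect lerDl !mulr_ge0 ?sqrtr_ge0 ?invr_ge0// !addr_ge0.
Qed.

(** Crude on purpose: it only limits the range of the harmonic sum over j, where a polynomial bound
    costs a logarithm. *)
Lemma tri_defect_le (R : realType) (N q1 q2 q3 : nat) (w1 w2 w3 : R) :
  (0 < N)%N -> (0 < q1 <= N)%N -> (0 < q2 <= N)%N -> (0 < q3 <= N)%N ->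
  0 <= w1 <= N%:R -> 0 <= w2 <= N%:R -> 0 <= w3 <= N%:R ->
  tri_defect N q1 q2 q3 w1 w2 w3 <= 1 + 3 * N%:R ^+ 3.
Proof.
move=> N0 /andP[q10 q1N] /andP[q20 q2N] /andP[q30 q3N] /andP[w10 w1N] /andP[w20 w2N] /andP[w30 w3N].
have N0R : 0 < N%:R :> R by rewrite ltr0n.
have qqN : q1%:R * q2%:R * q3%:R <= N%:R ^+ 3 :> R.
  have -> : N%:R ^+ 3 = N%:R * N%:R * N%:R :> R by ring.
  by apply: ler_pM; rewrite ?mulr_ge0 ?ler_nat//; apply: ler_pM; rewrite ?ler_nat.
have qq1 : 1 <= q1%:R * q2%:R * q3%:R :> R.
  by rewrite -!natrM ler1n !muln_gt0 q10 q20 q30.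
have sq : Num.sqrt (q1%:R * q2%:R * q3%:R) <= N%:R ^+ 3 :> R.
  apply: le_trans qqN; rewrite -[leRHS]sqr_sqrtr ?(le_trans ler01)//.
  rewrite expr2 ler_peMr ?sqrtr_ge0// -[leLHS]sqrtr1; exact: ler_wsqrtr.
have ws : (w1 + w2 + w3) / N%:R <= 3 by rewrite ler_pdivrMr//; lra.
rewrite /tri_defect lerD2l -mulrA mulrC ler_pM ?sqrtr_ge0// divr_ge0//.
by rewrite !addr_ge0.
Qed.

(** The factor q1 / (q2 q3) is 1 / (d a^2) in the notation of [triangle_denominators]; the defect
    pays for the integer j, and the minimum for the position of the third vertex, which may be
    located from either end of the first edge. *)
Definition tri_weight (R : realType) (N q1 q2 q3 : nat) (w1 w2 w3 : R) : R :=
  q1%:R / (q2%:R * q3%:R) / tri_defect N q1 q2 q3 w1 w2 w3 / Num.min w2 w3.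

Lemma tri_weight_ge0 (R : realType) (N q1 q2 q3 : nat) (w1 w2 w3 : R) :
  0 <= w1 -> 0 <= w2 -> 0 <= w3 -> 0 <= tri_weight N q1 q2 q3 w1 w2 w3.
Proof.
move=> h1 h2 h3; have h := tri_defect_ge1 N q1 q2 q3 h1 h2 h3.
by rewrite /tri_weight !mulr_ge0 ?invr_ge0 ?mulr_ge0 ?(le_trans ler01 h)// le_min h2.
Qed.

(** The inverse of the minimum is at most the sum of the two inverses, so the third vertex is
    counted once from s and once from r; hence twice 324. *)
Lemma sum_triangles_on_edge (R : realType) (N : nat) (V : {set 'I_N}) (x t : 'I_N -> R)
    (ell P : R) (ed : rel 'I_N) (p : 'I_N -> 'I_N -> R) (Q : 'I_N -> 'I_N -> nat)
    (al m : 'I_N -> 'I_N -> int) :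
  (0 < N)%N -> 1 <= ell -> harm R (6 * N ^ 3).+3 <= ell ->
  (forall q, (0 < q <= N)%N -> (size (divisors q))%:R <= ell) ->
  3 * P ^+ 3 < N%:R ^+ 2 -> P <= N%:R ->
  (forall k, k \in V -> k%:R <= N%:R * x k <= k%:R + 1) ->
  (forall r s, ed r s -> r \in V /\ s \in V) ->
  (forall r s, ed r s -> p r s <= P) ->
  (forall r s, ed r s -> [/\ (0 < Q r s)%N, coprimez (al r s) (Q r s), (Q r s)%:R <= p r s,
    `|(Q r s)%:R * (x r - x s) - (m r s)%:~R| <= p r s / N%:R &
    `|(Q r s)%:R * (t r - t s) - (al r s)%:~R| <= p r s / N%:R ^+ 2]) ->
  forall r s, ed r s ->
  \sum_(u | ed s u && ed u r) tri_weight N (Q r s) (Q s u) (Q u r)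
     (p r s / (Q r s)%:R) (p s u / (Q s u)%:R) (p u r / (Q u r)%:R) <= 648 * ell ^+ 5.
Proof.
move=> N0 l1 lharm ldiv PN PN' hx edV pP edata r s e_rs.
have N0R : 0 < N%:R :> R by rewrite ltr0n.
have [n1 n2 n3] := cube_bounds N0.
have x01 k : k \in V -> 0 <= x k <= 1.
  move=> /hx /andP[a1 a2]; have kN : k%:R + 1 <= N%:R :> R by rewrite natr1 ler_nat.
  apply/andP; split; rewrite -(ler_pM2l N0R) ?mulr0 ?mulr1 ?(le_trans a2)//.
  by rewrite (le_trans _ a1).
have eb k l : ed k l -> [/\ 1 <= p k l / (Q k l)%:R, p k l / (Q k l)%:R <= N%:R,
    (`|m k l| <= 2 * Q k l)%N & (Q k l <= N)%N].
  move=> e_kl; have [a1 a2 a3 a4 a5] := edata _ _ e_kl.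
  apply: (edge_bounds N0 PN' a1 a3 (pP _ _ e_kl) _ a4).
  have [/x01/andP[b1 b2] /x01/andP[b3 b4]] := edV _ _ e_kl.
  by move: b1 b2 b3 b4; clear; rewrite ler_norml => *; apply/andP; split; lra.
pose w k l := p k l / (Q k l)%:R.
pose J u := tri_defect N (Q r s) (Q s u) (Q u r) (w r s) (w s u) (w u r).
pose V' := [set u | ed s u && ed u r].
have w0 k l : ed k l -> 0 <= w k l <= N%:R.
  by move=> /eb[a1 a2 _ _]; rewrite (le_trans ler01 a1).
have Q0N k l : ed k l -> (0 < Q k l <= N)%N.
  by move=> h; have [-> _ _ _ _] := edata _ _ h; have [_ _ _ ->] := eb _ _ h.
have /andP[w0rs _] := w0 _ _ e_rs.
have rel u : ed s u -> ed u r -> exists d a b c : nat, [/\ Q r s = (d * b * c)%N, Q s u = (d * a * c)%N,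
  Q u r = (d * a * b)%N, coprime b c &
  Num.max 1 `|(a%:Z * m r s + b%:Z * m s u + c%:Z * m u r)%:~R| <= J u :> R].
  move=> e2 e3.
  have [a1 a2 a3 a4 a5] := edata _ _ e_rs.
  have [b1 b2 b3 b4 b5] := edata _ _ e2.
  have [c1 c2 c3 c4 c5] := edata _ _ e3.
  have xs : (x r - x s) + (x s - x u) + (x u - x r) = 0 by ring.
  have ts : (t r - t s) + (t s - t u) + (t u - t r) = 0 by ring.
  have [d [a [b [c [f1 f2 f3 bc hj]]]]] := @triangle_relations R N _ _ _ _ _ _ _ _ _ _ _ _ _ _ _
    _ _ _ P N0 PN xs ts a1 b1 c1 a2 b2 c2 a3 b3 c3 (pP _ _ e_rs) (pP _ _ e2) (pP _ _ e3) a4 b4 c4 a5 b5 c5.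
  exists d, a, b, c; split=> //.
  have /andP[h2 _] := w0 _ _ e2; have /andP[h3 _] := w0 _ _ e3.
  rewrite ge_max tri_defect_ge1//=; apply: (le_trans hj).
  by rewrite /J /tri_defect /w lerDr ler01.
have jB (j : int) u : ed s u -> ed u r -> Num.max 1 `|j%:~R| <= J u -> (`|j| <= (3 * N ^ 3).+1)%N.
  move=> e2 e3; rewrite ge_max => /andP[_ h2].
  rewrite -(ler_nat R) -[leLHS]/(`|j|%:Z%:~R) abszE intr_norm -natr1 natrM natrX addrC.
  by apply: (le_trans h2); apply: tri_defect_le; rewrite ?w0 ?Q0N.
have lharm' : harm R (2 * (3 * N ^ 3).+1).+1 <= ell.
  by apply: le_trans lharm; apply: le_harm.
have lharmN : harm R N <= ell by apply: le_trans lharm; apply: le_harm.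
have q0 : (0 < Q r s)%N by have /andP[] := Q0N _ _ e_rs.
have divQ : (size (divisors (Q r s)))%:R <= ell by apply: ldiv; exact: Q0N.
have hX k : k \in V' -> k%:R <= N%:R * x k <= k%:R + 1.
  by rewrite inE => /andP[/edV[_ kV] _]; exact: hx.
have sumA : \sum_(u in V') (Q r s)%:R / ((Q s u)%:R * (Q u r)%:R) / J u / w s u <= 324 * ell ^+ 5.
  apply: (count_third_vertex (X := fun k => N%:R * x k) (y := N%:R * x s) (mu := - m r s)
     (Q := N) (B := (3 * N ^ 3).+1) (m := fun u => - m s u) hX q0 l1 lharmN lharmN lharm' divQ).
  - move=> u; rewrite inE => /andP[e2 e3]; have [d [a [b [c [f1 f2 f3 bc hj]]]]] := rel u e2 e3.
    exists d, a, b, c, (a%:Z * m r s + b%:Z * m s u + c%:Z * m u r); split; split=> //.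
    + have -> : b%:Z * - m s u + (a%:Z * m r s + b%:Z * m s u + c%:Z * m u r + a%:Z * - m r s) = c%:Z * m u r by ring.
      exact: dvdz_mulr.
    + exact: Q0N.
    + by have /andP[] := Q0N _ _ e3.
    + exact: jB e2 e3 hj.
    + by rewrite abszN; have [] := eb _ _ e2.
  - move=> u; rewrite inE => /andP[e2 _]; have [h1 _ _ _] := eb _ _ e2; rewrite ge_max h1/=.
    have [a0 _ _ hm _] := edata _ _ e2; apply: scaled_distance => //.
    by rewrite mulrNz -normrN; apply: le_trans hm; rewrite le_eqVlt; apply/orP; left; apply/eqP; congr (`|_|); ring.
(* Seen from r, the roles of b and c are exchanged and j changes sign. *)
have sumB : \sum_(u in V') (Q r s)%:R / ((Q u r)%:R * (Q s u)%:R) / J u / w u r <= 324 * ell ^+ 5.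
  apply: (count_third_vertex (X := fun k => N%:R * x k) (y := N%:R * x r) (mu := m r s)
     (Q := N) (B := (3 * N ^ 3).+1) (m := fun u => m u r) hX q0 l1 lharmN lharmN lharm' divQ).
  - move=> u; rewrite inE => /andP[e2 e3]; have [d [a [b [c [f1 f2 f3 bc hj]]]]] := rel u e2 e3.
    exists d, a, c, b, (- (a%:Z * m r s + b%:Z * m s u + c%:Z * m u r)); split; split=> //.
    + by rewrite f1 mulnAC.
    + by rewrite coprime_sym.
    + have -> : c%:Z * m u r + (- (a%:Z * m r s + b%:Z * m s u + c%:Z * m u r) + a%:Z * m r s) = b%:Z * - m s u by ring.
      exact: dvdz_mulr.
    + exact: Q0N.
    + by have /andP[] := Q0N _ _ e2.
    + by rewrite mulrNz normrN.
    + by rewrite abszN; exact: jB e2 e3 hj.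
    + by have [] := eb _ _ e3.
  - move=> u; rewrite inE => /andP[_ e3]; have [h1 _ _ _] := eb _ _ e3; rewrite ge_max h1/=.
    by have [a0 _ _ hm _] := edata _ _ e3; apply: scaled_distance.
have -> : 648 * ell ^+ 5 = 324 * ell ^+ 5 + 324 * ell ^+ 5 by ring.
apply: le_trans (lerD sumA sumB); rewrite -big_split /=.
rewrite [leRHS](eq_bigl (fun u => ed s u && ed u r)); last by move=> u; rewrite inE.
apply: ler_sum => u.
move=> /andP[e2 e3]; rewrite /tri_weight -/(J u).
have /andP[h2 _] := w0 _ _ e2; have /andP[h3 _] := w0 _ _ e3.
have j0 : 0 <= J u by rewrite (le_trans ler01)// tri_defect_ge1.
rewrite [X in _ + _ / X / _ / _]mulrC -mulrDr; apply: ler_wpM2l.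
  by rewrite !mulr_ge0 ?invr_ge0 ?mulr_ge0.
by rewrite minEle; case: ifP => _; rewrite ?lerDl ?lerDr invr_ge0.
Qed.

(** On an edge |K| >= M / 2, so the constants 50 and 80 of [weyl_inverse] turn into 200 and 320, and
    [P] bounds all the p of edges at once. *)
Lemma energy_bound (R : realType) (N : nat) (V : {set 'I_N}) (x t : 'I_N -> R) (M ell P : R) :
  (0 < N)%N -> 0 < M -> 1 <= ell -> harm R (6 * N ^ 3).+3 <= ell ->
  (forall q, (0 < q <= N)%N -> (size (divisors q))%:R <= ell) ->
  200 * ell * N%:R <= M ^+ 2 ->
  P = 320 * ell * N%:R ^+ 2 / M ^+ 2 -> 3 * P ^+ 3 < N%:R ^+ 2 ->
  (forall k, k \in V -> k%:R <= N%:R * x k <= k%:R + 1) ->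
  (forall v : 'I_N -> R, (forall k, 0 <= v k) ->
    M * (\sum_(k in V) v k) ^+ 2 <=
    \sum_(r in V) \sum_(s in V) v r * v s * normc (weyl_kernel N (x r - x s) (t r - t s))) ->
  #|V|%:R * M ^+ 2 <=
    12 * (80 * ell * N%:R ^+ 2 * (16 * (1 + 3 * (P ^+ 5 / N%:R ^+ 3)))) * (648 * ell ^+ 5).
Proof.
move=> N0 M0 l1 lharm ldiv MN PE PN hx dual.
have N0R : 0 < N%:R :> R by rewrite ltr0n.
have N1R : 1 <= N%:R :> R by rewrite ler1n.
have ell0 : 0 < ell by apply: lt_le_trans l1.
have [n1 n2 n3] := cube_bounds N0.
have P0 : 0 < P.
  have h : 0 < ell * N%:R ^+ 2 / M ^+ 2.
    by rewrite divr_gt0 ?exprn_gt0// mulr_gt0// exprn_gt0.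
  by rewrite PE; move: h; clear; lra.
have PN' : P <= N%:R.
  rewrite leNgt; apply/negP => NP.
  have h1 : N%:R ^+ 3 <= P ^+ 3 by rewrite ler_pXn2r ?nnegrE ?(ltW N0R) ?(ltW P0) ?(ltW NP).
  have h2 : N%:R ^+ 2 <= N%:R ^+ 3 :> R by rewrite ler_weXn2l.
  have h3 : 0 < N%:R ^+ 3 :> R by rewrite exprn_gt0.
  by move: h1 h2 h3 PN; clear; lra.
pose K r s := normc (weyl_kernel N (x r - x s) (t r - t s)).
have Ksym r s : K r s = K s r.
  by rewrite /K -normc_weyl_kernelN; congr (normc (weyl_kernel _ _ _)); ring.
have K0 r s : 0 <= K r s by exact: normc_ge0.
pose ed r s := [&& r \in V, s \in V & M / 2 <= K r s].
have edsym r s : ed r s = ed s r by rewrite /ed Ksym andbCA.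
pose f r s := if ed r s then K r s else 0.
have fsym r s : f r s = f s r by rewrite /f edsym Ksym.
have f0 r s : 0 <= f r s by rewrite /f; case: ifP.
pose L := 80 * ell.
have L0 : 0 < L by rewrite mulr_gt0.
pose p r s := L * N%:R ^+ 2 / K r s ^+ 2.
have edK r s : ed r s -> 0 < K r s.
  by move=> /and3P[_ _ h]; apply: lt_le_trans h; rewrite divr_gt0.
have edM r s : ed r s -> M ^+ 2 <= 4 * K r s ^+ 2.
  move=> /and3P[_ _ h].
  have : (M / 2) ^+ 2 <= K r s ^+ 2 by rewrite ler_pXn2r ?nnegrE// divr_ge0// ltW.
  by rewrite exprMn; clear; lra.
have pP r s : ed r s -> p r s <= P.
  move=> e_rs; have h2 := edM _ _ e_rs; have k0 := edK _ _ e_rs.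
  rewrite /p PE ler_pdivrMr ?exprn_gt0// [leRHS]mulrAC ler_pdivlMr ?exprn_gt0//.
  have h3 : 0 <= ell * N%:R ^+ 2 by rewrite mulr_ge0 ?exprn_ge0// ltW.
  by have := ler_wpM2l h3 h2; rewrite /L; clear; lra.
have data (rs : 'I_N * 'I_N) : exists z : nat * int * int, ed rs.1 rs.2 ->
  let: (q, al, m) := z in
  [/\ (0 < q)%N, coprimez al q, q%:R <= p rs.1 rs.2,
    `|q%:R * (x rs.1 - x rs.2) - m%:~R| <= p rs.1 rs.2 / N%:R &
    `|q%:R * (t rs.1 - t rs.2) - al%:~R| <= p rs.1 rs.2 / N%:R ^+ 2].
  case: rs => r s /=; have [e_rs|ne] := boolP (ed r s); last by exists (0%N, 0, 0).
  have [||q [al [m h]]] := @weyl_inverse R N (x r - x s) (t r - t s) ell N0 l1.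
  - by apply: le_trans lharm; apply: le_harm.
  - by rewrite -/(K r s); have := edM _ _ e_rs; move: MN; clear; lra.
  by exists (q, al, m).
have [Z hZ] := choice data.
pose Q r s := (Z (r, s)).1.1; pose al r s := (Z (r, s)).1.2; pose m r s := (Z (r, s)).2.
have edata r s : ed r s -> [/\ (0 < Q r s)%N, coprimez (al r s) (Q r s), (Q r s)%:R <= p r s,
    `|(Q r s)%:R * (x r - x s) - (m r s)%:~R| <= p r s / N%:R &
    `|(Q r s)%:R * (t r - t s) - (al r s)%:~R| <= p r s / N%:R ^+ 2].
  by move=> e_rs; have := hZ (r, s) e_rs; rewrite /Q /al /m /=; case: (Z (r, s)) => -[].
pose w r s := p r s / (Q r s)%:R.
have Q1 r s : ed r s -> 1 <= (Q r s)%:R :> R.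
  by move=> /edata[q0 _ _ _ _]; rewrite ler1n.
have w1 r s : ed r s -> 1 <= w r s.
  by move=> e_rs; have [q0 _ qp _ _] := edata _ _ e_rs; rewrite /w ler_pdivlMr ?mul1r ?ltr0n.
have Qw r s : ed r s -> (Q r s)%:R * w r s = p r s.
  move=> e_rs; have [q0 _ _ _ _] := edata _ _ e_rs.
  by rewrite /w mulrCA divff ?mulr1// pnatr_eq0 -lt0n.
have K2p r s : ed r s -> K r s ^+ 2 * ((Q r s)%:R * w r s) = L * N%:R ^+ 2.
  by move=> e_rs; rewrite Qw// /p mulrC divfK// expf_neq0// gt_eqF//; exact: edK.
pose tri r s u := [&& ed r s, ed s u & ed u r].
have tricyc r s u : tri s u r = tri r s u by rewrite /tri andbC -andbA andbC -andbA.
pose W0 r s u := tri_weight N (Q r s) (Q s u) (Q u r) (w r s) (w s u) (w u r).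
pose W r s u := if tri r s u then W0 r s u else 0.
have w0 r s : ed r s -> 0 <= w r s by move=> /w1; exact: le_trans.
have Wge r s u : 0 <= W r s u.
  by rewrite /W; case: ifP => // /and3P[/w0 a1 /w0 a2 /w0 a3]; exact: tri_weight_ge0.
set H := 16 * _.
have H0 : 0 < H by rewrite /H mulr_gt0// addr_gt0// mulr_gt0// divr_gt0// exprn_gt0.
pose Lam := L * N%:R ^+ 2 * H.
have Lam0 : 0 < Lam by rewrite /Lam mulr_gt0// mulr_gt0// exprn_gt0.
have triangle r s u : f r s * f s u * f u r <=
    Lam * (f r s * W r s u + f s u * W s u r + f u r * W u r s).
  have [T|T] := boolP (tri r s u); last first.
    have -> : f r s * f s u * f u r = 0.
      by move: T; rewrite /tri /f; case: (ed r s); case: (ed s u); case: (ed u r) => //= _;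
        rewrite !(mul0r, mulr0).
    by rewrite mulr_ge0 ?(ltW Lam0)// !addr_ge0// mulr_ge0.
  have T2 : tri s u r by rewrite tricyc.
  have T3 : tri u r s by rewrite tricyc.
  rewrite /W T T2 T3; have /and3P[e1 e2 e3] := T.
  rewrite /f e1 e2 e3 /W0 /tri_weight.
  rewrite (tri_defect_cycle N (Q r s) (Q s u) (Q u r)).
  rewrite -(tri_defect_cycle N (Q u r) (Q r s) (Q s u)).
  by apply: triangle_product_le; rewrite ?K2p ?Qw ?pP ?Q1 ?w1 ?edK.
have sumW r s : ed r s -> \sum_u W r s u <= 648 * ell ^+ 5.
  move=> e_rs.
  apply: le_trans (@sum_triangles_on_edge R N V x t ell P ed p Q al m N0 l1 lharm ldiv PN PN' hx _ pP edata r s e_rs).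
    rewrite [leRHS]big_mkcond /=; apply: ler_sum => u _.
    by rewrite /W /tri e_rs.
  by move=> k l /and3P[].
have B0 : 0 <= 648 * ell ^+ 5.
  by apply: mulr_ge0; [exact: ler0n | apply: exprn_ge0; exact: ltW].
apply: (triangle_energy (f := f) (W := W)) => //; first exact: ltW.
- by move=> r s rV; rewrite /f /ed (negbTE rV).
- move=> r s; rewrite /f; case: ifP => e_rs; last by rewrite mul0r mulr0.
  by rewrite mulrC ler_wpM2r// sumW.
- move=> v v0; have h := dual v v0.
  (* Pairs that are not edges contribute at most M / 2 times the square of the sum of v, half of the
     lower bound given by duality. *)
  have h2 : \sum_(r in V) \sum_(s in V) v r * v s * K r s <=
    \sum_(r in V) \sum_(s in V) v r * v s * f r s + M / 2 * (\sum_(k in V) v k) ^+ 2.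
    rewrite expr2 mulr_suml mulr_sumr -big_split /=; apply: ler_sum => r rV.
    rewrite mulr_sumr mulr_sumr -big_split /=; apply: ler_sum => s sV.
    have vv : 0 <= v r * v s by rewrite mulr_ge0.
    have kf : K r s <= f r s + M / 2.
      have M2 : 0 <= M / 2 by rewrite divr_ge0// ltW.
      rewrite /f; case: ifP => [_|]; first by rewrite lerDl.
      by rewrite /ed rV sV /= => /negbT; rewrite -ltNge add0r; exact: ltW.
    by have := ler_wpM2l vv kf; clear; lra.
  have h3 : \sum_(r in V) \sum_(s in V) v r * v s * f r s <= \sum_r \sum_s v r * v s * f r s.
    rewrite big_mkcond; apply: ler_sum => r _; case: ifP => _.
      by rewrite big_mkcond; apply: ler_sum => s _; case: ifP => _ //; rewrite !mulr_ge0.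
    by apply: sumr_ge0 => s _; rewrite !mulr_ge0.
  by move: h h2 h3; rewrite /K; clear; lra.
Qed.

(** * Duality and discretization *)

Lemma le_sum_uniq_sub (R : numDomainType) (T : eqType) (s r : seq T) (g : T -> R) :
  uniq s -> uniq r -> {subset s <= r} -> (forall i, 0 <= g i) ->
  \sum_(i <- s) g i <= \sum_(i <- r) g i.
Proof.
move=> us ur sr g0; rewrite [leRHS](bigID (mem s)) /=.
have -> : \sum_(i <- r | i \in s) g i = \sum_(i <- s) g i.
  rewrite -big_filter; apply: perm_big; apply: uniq_perm => //; first exact: filter_uniq.
  by move=> i; rewrite mem_filter; case: (boolP (i \in s)) => // /sr ->.
by rewrite lerDl sumr_ge0.
Qed.

Lemma normc_unit_phase (R : realType) (z : R[i]) : 0 < normc z ->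
  exists c : R[i], normc c = 1 /\ c * z = (normc z)%:C.
Proof.
move=> z0; exists ((z^*)%C * (normc z)^-1%:C); split.
  rewrite ComplexField.Normc.normcM normcJ_eq normc_real ger0_norm ?invr_ge0 ?ltW//.
  by rewrite divff// gt_eqF.
have -> : (z^*)%C * (normc z)^-1%:C * z = (z * (z^*)%C) * (normc z)^-1%:C by ring.
by rewrite -normc_sqr -rmorphM /= expr2 mulfK// gt_eqF.
Qed.

(* Cauchy-Schwarz over n, after which the phase e (n^3 theta), which does not
   depend on the point, has disappeared. *)
Lemma weyl_sum_duality (R : realType) (N : nat) (A : {fset nat}) (theta lam : R)
    (V : {set 'I_N}) (x t : 'I_N -> R) :
  (0 < N)%N -> 0 < lam -> (forall n, n \in A -> (1 <= n <= N)%N) ->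
  (forall k, k \in V -> lam <= normc (weyl_sum N A (x k) (t k) theta)) ->
  forall v : 'I_N -> R, (forall k, 0 <= v k) ->
    lam ^+ 2 * (\sum_(k in V) v k) ^+ 2 <=
    \sum_(r in V) \sum_(s in V) v r * v s * normc (weyl_kernel N (x r - x s) (t r - t s)).
Proof.
move=> N0 lam0 AN hV v v0.
have N0R : 0 < N%:R :> R by rewrite ltr0n.
pose F k : R[i] := \sum_(n <- A) e (n%:R * x k + n%:R ^+ 2 * t k + n%:R ^+ 3 * theta).
pose h : R := N%:R `^ (- 2^-1).
have h0 : 0 < h by rewrite powR_gt0.
have hh : h ^+ 2 * N%:R = 1.
  rewrite -powR_mulrn ?(ltW h0)// /h -powRrM mulNr mulVf// powRN powRr1 ?ltW//.
  by rewrite mulVf// gt_eqF.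
have hF k : k \in V -> lam <= h * normc (F k).
  by move=> /hV; rewrite /weyl_sum ComplexField.Normc.normcM normc_real ger0_norm// ltW.
have F0 k : k \in V -> 0 < normc (F k).
  by move=> kV; rewrite -(pmulr_rgt0 _ h0); apply: lt_le_trans (hF k kV).
have /choice[c hc] : forall k, exists c : R[i], k \in V -> normc c = 1 /\ c * F k = (normc (F k))%:C.
  move=> k; have [kV|kV] := boolP (k \in V); last by exists 0.
  by have [c hc] := normc_unit_phase (F0 k kV); exists c.
pose G (n : nat) : R[i] := \sum_(k in V) (v k)%:C * c k * e (n%:R * x k + n%:R ^+ 2 * t k).
pose S := \sum_(k in V) v k.
have S0 : 0 <= S by apply: sumr_ge0.
(* The unimodular [c k] make each [c k * F k] a nonnegative real, so the sums can be added without
   loss and n brought outside. *)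
have step1 : lam * S <= h * \sum_(n <- A) normc (G n).
  have -> : lam * S = \sum_(k in V) v k * lam by rewrite -mulr_suml mulrC.
  apply: (@le_trans _ _ (h * \sum_(k in V) v k * normc (F k))).
    by rewrite mulr_sumr; apply: ler_sum => k kV; rewrite mulrCA ler_wpM2l// hF.
  rewrite ler_pM2l//.
  have E : (\sum_(k in V) v k * normc (F k))%:C =
     \sum_(n <- A) e (n%:R ^+ 3 * theta) * G n.
    rewrite rmorph_sum /=.
    transitivity (\sum_(k in V) \sum_(n <- A)
       e (n%:R ^+ 3 * theta) * ((v k)%:C * c k * e (n%:R * x k + n%:R ^+ 2 * t k))).
      apply: eq_bigr => k kV; have [_ cF] := hc k kV.
      rewrite rmorphM /= -cF /F mulrA mulr_sumr; apply: eq_bigr => n _.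
      by rewrite eD; ring.
    by rewrite exchange_big /=; apply: eq_bigr => n _; rewrite mulr_sumr.
  have -> : \sum_(k in V) v k * normc (F k) = normc (\sum_(k in V) v k * normc (F k))%:C.
    by rewrite normc_real ger0_norm// sumr_ge0// => k _; rewrite mulr_ge0// normc_ge0.
  rewrite E; apply: (le_trans (normc_sum _ _ _)); apply: ler_sum => n _.
  by rewrite ComplexField.Normc.normcM normc_e mul1r.
have Aiota : {subset (A : seq nat) <= iota 1 N}.
  by move=> n /AN; rewrite mem_iota add1n ltnS.
(* After Cauchy-Schwarz the summands are nonnegative, so [A] may be enlarged to all of 1, ..., N;
   this is what makes the complete quadratic sum appear. *)
have step2 : (\sum_(n <- A) normc (G n)) ^+ 2 <= N%:R * \sum_(i < N) normc (G i.+1) ^+ 2.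
  apply: (le_trans (sqr_sum_le _ _ _)); apply: ler_pM.
  - by rewrite sumr_ge0.
  - by rewrite sumr_ge0// => n _; rewrite sqr_ge0.
  - apply: (le_trans (le_sum_uniq_sub (g := fun _ => 1) _ _ Aiota _)); rewrite ?iota_uniq ?fset_uniq//.
    by rewrite big_const_seq count_predT size_iota iter_addr_0.
  - apply: (le_trans (le_sum_uniq_sub (g := fun n => normc (G n) ^+ 2) _ _ Aiota _)); rewrite ?iota_uniq ?fset_uniq//.
      by move=> n; exact: sqr_ge0.
    rewrite -[iota 1 N]/(iota (1 + 0)%N N) iotaDl big_map.
    have -> : iota 0 N = index_iota 0 N by rewrite /index_iota subn0.
    by rewrite big_mkord.
have step3 : \sum_(i < N) normc (G i.+1) ^+ 2 <=
    \sum_(r in V) \sum_(s in V) v r * v s * normc (weyl_kernel N (x r - x s) (t r - t s)).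
  have E : (\sum_(i < N) normc (G i.+1) ^+ 2)%:C =
    \sum_(r in V) \sum_(s in V) ((v r * v s)%:C * (c r * (c s)^*%C)) * weyl_kernel N (x r - x s) (t r - t s).
    rewrite rmorph_sum /=.
    under eq_bigr => i _ do rewrite normc_sqr /G conjc_sum mulr_suml.
    rewrite exchange_big /=; apply: eq_bigr => r _.
    under eq_bigr => i _ do rewrite mulr_sumr.
    rewrite exchange_big /=; apply: eq_bigr => s _.
    rewrite /weyl_kernel mulr_sumr; apply: eq_bigr => i _.
    have -> : i.+1%:R * (x r - x s) + i.+1%:R ^+ 2 * (t r - t s) =
      (i.+1%:R * x r + i.+1%:R ^+ 2 * t r) + - (i.+1%:R * x s + i.+1%:R ^+ 2 * t s) :> R by ring.
    set a := i.+1%:R * x r + _; set b := i.+1%:R * x s + _.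
    by rewrite (eD a) eN !conjcM conjc_real rmorphM; ring.
  have -> : \sum_(i < N) normc (G i.+1) ^+ 2 = normc (\sum_(i < N) normc (G i.+1) ^+ 2)%:C.
    by rewrite normc_real ger0_norm// sumr_ge0// => i _; rewrite sqr_ge0.
  rewrite E; apply: (le_trans (normc_sum _ _ _)); apply: ler_sum => r rV.
  apply: (le_trans (normc_sum _ _ _)); apply: ler_sum => s sV.
  rewrite !ComplexField.Normc.normcM normc_real ger0_norm ?mulr_ge0//.
  by rewrite normcJ_eq (hc r rV).1 (hc s sV).1 !mulr1.
rewrite -exprMn -/S; apply: le_trans step3.
apply: (@le_trans _ _ ((h * \sum_(n <- A) normc (G n)) ^+ 2)).
  have G0 : 0 <= \sum_(n <- A) normc (G n) by rewrite sumr_ge0// => n _; rewrite normc_ge0.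
  have h1 : 0 <= h * \sum_(n <- A) normc (G n) by rewrite mulr_ge0// ltW.
  have h2 : 0 <= lam * S by rewrite mulr_ge0// ltW.
  by rewrite ler_pXn2r.
rewrite exprMn; apply: (le_trans (ler_wpM2l (sqr_ge0 h) step2)).
by rewrite mulrA hh mul1r.
Qed.

(** * Measure of a set bounded by the number of cells it meets *)

Local Open Scope classical_set_scope.

(** [lebesgue_measure] unfolds to an outer measure, which is monotone on arbitrary sets; this covers
    the level set, whose measurability is never established. *)
Lemma lebesgue_measure_mono (R : realType) (A B : set R) : A `<=` B ->
  (lebesgue_measure A <= lebesgue_measure B)%E.
Proof.
move=> AB; rewrite /lebesgue_measure /lebesgue_stieltjes_measure /measure_extension /=.
exact: le_outer_measure.
Qed.

Lemma lebesgue_measure_setU_le (R : realType) (A B : set R) :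
  (lebesgue_measure (A `|` B) <= lebesgue_measure A + lebesgue_measure B)%E.
Proof.
rewrite /lebesgue_measure /lebesgue_stieltjes_measure /measure_extension /=.
exact: outer_measureU2.
Qed.

Lemma measure_le_cells (R : realType) (N : nat) (E : set R) : (0 < N)%N ->
  (forall y, E y -> 0 <= y <= 1) ->
  exists (V : {set 'I_N}) (x : 'I_N -> R),
    (forall k, k \in V -> E (x k) /\ k%:R <= N%:R * x k <= k%:R + 1) /\
    (lebesgue_measure E <= (#|V|%:R / N%:R)%:E)%E.
Proof.
move=> N0 E01.
have N0R : 0 < N%:R :> R by rewrite ltr0n.
pose C (k : 'I_N) (y : R) := E y /\ k%:R <= N%:R * y <= k%:R + 1.
pose V := [set k | `[< exists y, C k y >]]%SET.
have /choice[x hx] : forall k, exists y, k \in V -> C k y.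
  move=> k; have [|kV] := boolP (k \in V); last by exists 0.
  by rewrite inE => /asboolP[y hy]; exists y.
exists V, x; split; first by move=> k; exact: hx.
pose I (k : 'I_N) : set R := `[k%:R / N%:R, (k%:R + 1) / N%:R].
have cover : E `<=` \big[setU/set0]_(k in V) I k.
  move=> y Ey; have /andP[y0 y1] := E01 y Ey.
  have [k kC] : exists k, C k y.
    have Ny0 : 0 <= N%:R * y by rewrite mulr_ge0.
    have Ny1 : N%:R * y <= N%:R by rewrite ler_piMr.
    have /andP[t1 t2] := truncn_itv Ny0; rewrite -natr1 in t2.
    have [tN|tN] := ltnP (Num.truncn (N%:R * y)) N.
      by exists (Ordinal tN); split=> //=; rewrite t1 ltW.
    (* Only y = 1 gets here; it belongs to the last cell because cells are closed. *)
    have pN : (N.-1 < N)%N by rewrite prednK.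
    exists (Ordinal pN); split=> //=.
    have e1 : N.-1%:R + 1 = N%:R :> R by rewrite natr1 prednK.
    have : N%:R <= (Num.truncn (N%:R * y))%:R :> R by rewrite ler_nat.
    by move=> h; rewrite e1 Ny1 andbT; move: t1 e1 h; clear; lra.
  have kV : k \in V by rewrite inE; apply/asboolP; exists y.
  rewrite -bigcup_seq_cond; exists k => /=; first by rewrite mem_index_enum.
  rewrite /I /= in_itv /=; have [_ /andP[k1 k2]] := kC.
  by rewrite ler_pdivrMr// ler_pdivlMr// ![y * _]mulrC k1.
apply: (le_trans (lebesgue_measure_mono cover)).
apply: (@le_trans _ _ (\sum_(k in V) (N%:R^-1)%:E)%E).
  elim/big_rec2 : _ => [|k a A _ h]; first by rewrite measure0.
  apply: (le_trans (lebesgue_measure_setU_le _ _)); apply: leeD => //.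
  rewrite /I lebesgue_measure_itv /= lte_fin ltr_pM2r ?invr_gt0// ltrDl ltr01.
  by rewrite -EFinB lee_fin -mulrBl addrAC subrr add0r mul1r.
by rewrite sumEFin lee_fin sumr_const -[leLHS]mulr_natl.
Qed.

Local Close Scope classical_set_scope.

(** * Harmonic sums and divisors *)

Lemma harm_le_ln (R : realType) (n : nat) : harm R n.+1 <= 1 + ln (n.+1%:R : R).
Proof.
elim: n => [|n IH]; first by rewrite /harm big_ord1 invr1 ln1 addr0.
rewrite /harm big_ord_recr /= -/(harm R n.+1).
have n0 : 0 < n.+2%:R :> R by rewrite ltr0n.
have h : ln (1 + - n.+2%:R^-1) <= - n.+2%:R^-1 :> R.
  by apply: le_ln1Dx; rewrite ltrN2 invf_lt1// ltr1n.
have e1 : 1 + - n.+2%:R^-1 = n.+1%:R / n.+2%:R :> R.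
  have -> : n.+1%:R = n.+2%:R - 1 :> R by rewrite -(natr1 n.+1) addrK.
  by rewrite mulrBl mul1r divff// gt_eqF.
move: h IH; rewrite e1 ln_div ?posrE ?ltr0n// /harm => h IH.
move: (ln n.+1%:R) (ln n.+2%:R) (n.+2%:R^-1) (\sum_(i < n.+1) _) h IH => a b c d; clear; lra.
Qed.

Lemma powR_ge1 (R : realType) (a r : R) : 1 <= a -> 0 <= r -> 1 <= a `^ r.
Proof. by move=> a1 r0; rewrite -[leLHS](powRr0 a); apply: ler_powR. Qed.

(** A logarithm is below any power: ln x = eta^-1 ln (x^eta) <= eta^-1 x^eta. *)
Lemma harm_le_powR (R : realType) (eta : R) (n : nat) : 0 < eta -> (0 < n)%N ->
  harm R n <= (1 + eta^-1) * n%:R `^ eta.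
Proof.
move=> eta0; case: n => // n _; apply: (le_trans (harm_le_ln R n)).
have n1 : 1 <= n.+1%:R :> R by rewrite ler1n.
have p1 : 1 <= n.+1%:R `^ eta :> R by rewrite powR_ge1// ltW.
have : ln (n.+1%:R `^ eta) <= n.+1%:R `^ eta :> R.
  by rewrite ltW// ln_sublinear// (lt_le_trans ltr01).
rewrite ln_powR => h.
have : ln n.+1%:R <= eta^-1 * n.+1%:R `^ eta :> R by rewrite mulrC ler_pdivlMr// mulrC.
by rewrite mulrDl mul1r; lra.
Qed.

Lemma size_divisors_split (n p : nat) : (0 < n)%N -> prime p ->
  (size (divisors n) <= (logn p n).+1 * size (divisors n`_p^'))%N.
Proof.
move=> n0 pp.
pose s := [seq (p ^ i * D)%N | i <- iota 0 (logn p n).+1, D <- divisors n`_p^'].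
have -> : ((logn p n).+1 * size (divisors n`_p^'))%N = size s by rewrite size_allpairs size_iota.
apply: uniq_leq_size; first exact: divisors_uniq.
move=> D; rewrite -dvdn_divisors// => Dn.
have D0 : (0 < D)%N by apply: dvdn_gt0 Dn.
apply/allpairsP; exists (logn p D, D`_p^')%N; split.
- by rewrite mem_iota leq0n add0n ltnS dvdn_leq_log.
- by rewrite -dvdn_divisors ?part_gt0// partn_dvd.
- by rewrite -p_part partnC.
Qed.

(** The quotient of the number of divisors by n^del is a product of (e + 1) / p^(e del) over the
    primes of n. Primes p >= P0 satisfy p^del >= 2 and contribute at most 1, because e + 1 <= 2^e;
    each smaller prime contributes at most B. The induction removes the least prime factor. *)
Lemma divisors_small_primes (R : realType) (del B : R) (P0 : nat) :
  0 < del -> 1 <= B -> (forall e : nat, e.+1%:R <= B * (2%:R `^ del) ^+ e) ->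
  2 <= P0%:R `^ del ->
  forall n, (0 < n)%N ->
    (size (divisors n))%:R <= B ^+ count (fun p => (p < P0)%N) (primes n) * n%:R `^ del.
Proof.
move=> del0 B1 hB hP n; have [k] := ubnP n; elim: k n => // k IH n nk n0.
have [n1|n1] := leqP n 1.
  have -> : n = 1%N by lia.
  by rewrite powR1 mulr1 /= expr0.
set p := pdiv n; have pp : prime p by rewrite pdiv_prime.
set e := logn p n; set m := (n`_p^')%N.
have nE : n = (p ^ e * m)%N by rewrite -p_part partnC.
have m0 : (0 < m)%N by rewrite part_gt0.
have e0 : (0 < e)%N by rewrite logn_gt0 mem_primes pp n0 pdiv_dvd.
have mn : (m < n)%N.
  rewrite [ltnRHS]nE ltn_Pmull//; apply: leq_trans (prime_gt1 pp) _.
  by rewrite -{1}(expn1 p) leq_pexp2l// prime_gt0.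
have cnt : (count (fun p => (p < P0)%N) (primes n) >= (p < P0) + count (fun p => (p < P0)%N) (primes m))%N.
  rewrite /m primes_part count_filter.
  have pin : p \in primes n by rewrite mem_primes pp n0 pdiv_dvd.
  rewrite !(permP (perm_to_rem pin)) /= !inE eqxx andbF add0n leq_add2l.
  by apply: sub_count => q /= /andP[].
have pd0 : 0 <= p%:R `^ del :> R by exact: powR_ge0.
have factor : e.+1%:R <= B ^+ (p < P0)%N * (p%:R `^ del) ^+ e :> R.
  have [pP|Pp] := ltnP p P0.
    rewrite expr1; apply: (le_trans (hB e)); rewrite ler_wpM2l ?(le_trans ler01)//.
    rewrite lerXn2r ?nnegrE ?powR_ge0//; apply: ge0_ler_powR; rewrite ?nnegrE ?(ltW del0)//.
    by rewrite ler_nat prime_gt1.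
  rewrite expr0 mul1r.
  have p2 : 2 <= p%:R `^ del :> R.
    by apply: (le_trans hP); apply: ge0_ler_powR; rewrite ?nnegrE ?ler_nat ?(ltW del0).
  apply: (@le_trans _ _ (2 ^+ e)); last by rewrite lerXn2r ?nnegrE.
  by rewrite -natrX ler_nat ltn_expl.
have nd : n%:R `^ del = (p%:R `^ del) ^+ e * m%:R `^ del :> R.
  rewrite {1}nE natrM powRM// natrX; congr (_ * _).
  by rewrite -(powR_mulrn e (ler0n R p)) -(powR_mulrn e pd0) -!powRrM mulrC.
have := size_divisors_split n0 pp; rewrite -/e -/m -(ler_nat R) natrM => h.
apply: (le_trans h).
have IHm := IH m (leq_trans mn nk) m0.
apply: (@le_trans _ _ ((B ^+ (p < P0)%N * (p%:R `^ del) ^+ e) *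
   (B ^+ count (fun p => (p < P0)%N) (primes m) * m%:R `^ del))).
  by apply: ler_pM.
rewrite nd mulrACA -exprD; apply: ler_wpM2r; first by rewrite mulr_ge0 ?exprn_ge0 ?powR_ge0.
exact: ler_weXn2l.
Qed.

Lemma size_divisors_le_powR (R : realType) (del : R) : 0 < del ->
  exists2 C : R, 1 <= C & forall n, (0 < n)%N -> (size (divisors n))%:R <= C * n%:R `^ del.
Proof.
move=> del0.
set beta := 2%:R `^ del : R.
have b1 : 1 < beta.
  have := gt0_ltr_powR del0 (x := 1) (y := 2); rewrite powR1; apply; rewrite ?nnegrE//.
  by rewrite ltr1n.
have bern (e : nat) : 1 + e%:R * (beta - 1) <= beta ^+ e.
  elim: e => [|e IH]; first by rewrite expr0 mul0r addr0.
  rewrite exprS -natr1.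
  have b0 : 0 <= beta by lra.
  have := ler_wpM2l b0 IH.
  have : 0 <= e%:R * (beta - 1) ^+ 2 by rewrite mulr_ge0 ?sqr_ge0.
  by rewrite expr2; lra.
(* By Bernoulli e (beta - 1) <= beta^e; dividing by beta - 1 and adding 1 <= beta^e gives e + 1 <= B
   beta^e. *)
pose B := 1 + (beta - 1)^-1.
have B1 : 1 <= B by rewrite lerDl invr_ge0; lra.
have hB (e : nat) : e.+1%:R <= B * beta ^+ e.
  have h := bern e; have b0 : 0 < beta - 1 by lra.
  have h2 : e%:R = (beta - 1)^-1 * (e%:R * (beta - 1)) by field; rewrite gt_eqF.
  have h3 : (beta - 1)^-1 * (e%:R * (beta - 1)) <= (beta - 1)^-1 * beta ^+ e.
    by rewrite ler_wpM2l ?invr_ge0 ?(ltW b0)//; lra.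
  have h4 : 1 <= beta ^+ e by rewrite exprn_ege1// ltW.
  by rewrite -natr1 /B mulrDl mul1r h2; lra.
pose P0 := (Num.truncn (2 `^ del^-1 : R)).+1.
have hP : 2 <= P0%:R `^ del :> R.
  have h : 2 `^ del^-1 <= P0%:R :> R by rewrite ltW// /P0 truncnS_gt.
  have := @ge0_ler_powR R del (ltW del0) _ _ _ _ h.
  rewrite -powRrM mulVf ?gt_eqF// powRr1//; apply; rewrite nnegrE ?powR_ge0//.
exists (B ^+ P0); first exact: exprn_ege1.
move=> n n0; apply: (le_trans (divisors_small_primes del0 B1 hB hP n0)).
rewrite ler_wpM2r ?powR_ge0// ler_weXn2l//.
rewrite -size_filter -[leqRHS](size_iota 0); apply: uniq_leq_size; first by rewrite filter_uniq// primes_uniq.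
by move=> q; rewrite mem_filter mem_iota leq0n add0n => /andP[].
Qed.

(** * Conclusion *)

Lemma level_set_points (R : realType) (N : nat) (A : {fset nat}) (theta lambda : R) :
  (0 < N)%N -> 0 < lambda -> (forall n, n \in A -> (1 <= n <= N)%N) ->
  exists (V : {set 'I_N}) (x t : 'I_N -> R),
    [/\ forall k, k \in V -> k%:R <= N%:R * x k <= k%:R + 1,
      forall v : 'I_N -> R, (forall k, 0 <= v k) ->
        lambda ^+ 2 / 4 * (\sum_(k in V) v k) ^+ 2 <=
        \sum_(r in V) \sum_(s in V) v r * v s * normc (weyl_kernel N (x r - x s) (t r - t s)) &
      (lebesgue_measure (level_set N A theta lambda) <= (#|V|%:R / N%:R)%:E)%E].
Proof.
move=> N0 l0 AN.
have [V [x [hx hV]]] : exists (V : {set 'I_N}) (x : 'I_N -> R),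
    (forall k, k \in V -> level_set N A theta lambda (x k) /\ k%:R <= N%:R * x k <= k%:R + 1) /\
    (lebesgue_measure (level_set N A theta lambda) <= (#|V|%:R / N%:R)%:E)%E.
  by apply: measure_le_cells => // y [].
(* The supremum over t need not be attained, so only half of [lambda] is asked for; hence lambda^2 /
   4. *)
have /choice[t ht] : forall k, exists t, k \in V -> lambda / 2 <= normc (weyl_sum N A (x k) t theta).
  move=> k; have [kV|kV] := boolP (k \in V); last by exists 0.
  have [[_ lm] _] := hx k kV.
  apply: contrapT => no.
  have : maximal_weyl_sum N A theta (x k) <= lambda / 2.
    apply: ge_sup; first by exists (normc (weyl_sum N A (x k) 0 theta)); exists 0.
    move=> _ [t _ <-]; rewrite leNgt; apply/negP => h; apply: no; exists t => _.
    exact: ltW.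
  by move: lm l0; clear; lra.
exists V, x, t; split => //; first by move=> k /hx[].
move=> v v0; have -> : lambda ^+ 2 / 4 = (lambda / 2) ^+ 2 by field.
by apply: (weyl_sum_duality (A := A) (theta := theta)) => //; rewrite divr_gt0.
Qed.

(* To be read with z = N^(1/20) and y = N^del. *)
Lemma level_bounds (R : realType) (z y D c lam P : R) :
  1 <= z -> 1 <= y -> 1 <= D -> 1 <= c -> 0 < lam -> z ^+ 7 <= c * y * lam ->
  y ^+ 15 <= z ^+ 2 -> 3 * (320 * 16 * D * c ^+ 4) ^+ 3 < z ^+ 2 ->
  P = 320 * (D * y) * (z ^+ 20) ^+ 2 / (lam ^+ 2 / 4) ^+ 2 ->
  [/\ 200 * (D * y) * z ^+ 20 <= (lam ^+ 2 / 4) ^+ 2,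
      3 * P ^+ 3 < (z ^+ 20) ^+ 2 &
      1 + 3 * (P ^+ 5 / (z ^+ 20) ^+ 3) <= 4 * (320 * 16 * D * c ^+ 4) ^+ 5 * y ^+ 25].
Proof.
move=> z1 y1 D1 c1 l0 zl yz.
have z0 : 0 < z by apply: lt_le_trans z1.
have y0 : 0 < y by apply: lt_le_trans y1.
have D0 : 0 < D by apply: lt_le_trans D1.
have c0 : 0 < c by apply: lt_le_trans c1.
have l4 : 0 < lam ^+ 4 by rewrite exprn_gt0.
have c41 : 1 <= c ^+ 4 by rewrite exprn_ege1.
have PE2 : 320 * (D * y) * (z ^+ 20) ^+ 2 / (lam ^+ 2 / 4) ^+ 2 = (320 * 16 * D) * y * z ^+ 40 / lam ^+ 4.
  by field; rewrite gt_eqF.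
rewrite {}PE2; set B := 320 * 16 * D.
have BD : 16 * 200 * D <= B by rewrite /B; move: D0; clear; lra.
have B1 : 1 <= B by rewrite /B; move: D1; clear; lra.
move: B BD B1 => B BD B1 Az PE2.
have B0 : 0 < B by apply: lt_le_trans B1.
have [A0 AE] : exists A0, A0 = B * c ^+ 4 by exists (B * c ^+ 4).
rewrite -AE in Az *.
have A1 : 1 <= A0 by rewrite AE mulr_ege1.
have A00 : 0 < A0 by apply: lt_le_trans A1.
have z4 : z ^+ 28 <= c ^+ 4 * y ^+ 4 * lam ^+ 4.
  have -> : z ^+ 28 = (z ^+ 7) ^+ 4 by rewrite -exprM.
  have h0 : 0 <= z ^+ 7 by rewrite exprn_ge0// ltW.
  have h1 : 0 <= c * y * lam by exact: le_trans zl.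
  by rewrite -!exprMn lerXn2r.
have zn k : 1 <= z ^+ k by rewrite exprn_ege1.
have yn k : 1 <= y ^+ k by rewrite exprn_ege1.
have zp k : 0 < z ^+ k by rewrite exprn_gt0.
have yp k : 0 < y ^+ k by rewrite exprn_gt0.
have P0 : 0 <= P.
  by rewrite PE2; apply: divr_ge0; [apply: ltW; rewrite mulr_gt0// mulr_gt0 | exact: ltW].
(* Here z^12 is N^(3/5). In P^5 / N^3 the powers of z cancel exactly, whereas P^3 < N^2 leaves a
   spare z^4: one z^2 absorbs y^15 and the other the constants. *)
have PA : P <= A0 * y ^+ 5 * z ^+ 12.
  rewrite PE2 ler_pdivrMr//.
  have -> : B * y * z ^+ 40 = (B * y * z ^+ 12) * z ^+ 28 by ring.
  have -> : A0 * y ^+ 5 * z ^+ 12 * lam ^+ 4 = (B * y * z ^+ 12) * (c ^+ 4 * y ^+ 4 * lam ^+ 4).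
    by rewrite AE; ring.
  by apply: ler_wpM2l => //; apply: ltW; rewrite mulr_gt0// mulr_gt0.
have A3 : A0 <= A0 ^+ 3 by rewrite -[leLHS]expr1 ler_weXn2l.
have AYZ : 0 <= A0 * y ^+ 5 * z ^+ 12 by exact: le_trans PA.
have PQ k : P ^+ k <= (A0 * y ^+ 5 * z ^+ 12) ^+ k by rewrite lerXn2r.
split.
- have h1 : 200 * (D * y) * z ^+ 20 * (16 * c ^+ 4 * y ^+ 4) <= z ^+ 28.
    have -> : 200 * (D * y) * z ^+ 20 * (16 * c ^+ 4 * y ^+ 4) = (16 * 200 * D * c ^+ 4) * y ^+ 5 * z ^+ 20 by ring.
    have -> : z ^+ 28 = z ^+ 4 * z ^+ 4 * z ^+ 20 by ring.
    have h5 : y ^+ 5 <= z ^+ 4.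
      apply: (@le_trans _ _ (y ^+ 15)); first by rewrite ler_weXn2l.
      by apply: (le_trans yz); rewrite ler_weXn2l.
    have h6 : 16 * 200 * D * c ^+ 4 <= z ^+ 4.
      have h : z ^+ 2 <= z ^+ 4 by rewrite ler_weXn2l.
      have a3 : A0 <= z ^+ 4 by move: A3 Az h A1; clear; lra.
      apply: le_trans a3; rewrite AE ler_wpM2r//; exact: le_trans c41.
    apply: ler_wpM2r; first exact: ltW.
    apply: (@le_trans _ _ (z ^+ 4 * y ^+ 5)); first by rewrite ler_wpM2r// ltW.
    by apply: ler_wpM2l => //; exact: ltW.
  have h2 := le_trans h1 z4.
  have cy : 0 < c ^+ 4 * y ^+ 4 by rewrite mulr_gt0 ?exprn_gt0.
  rewrite -(ler_pM2r cy).
  have -> : (lam ^+ 2 / 4) ^+ 2 * (c ^+ 4 * y ^+ 4) = c ^+ 4 * y ^+ 4 * lam ^+ 4 / 16 by field.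
  by rewrite ler_pdivlMr//; apply: le_trans h2; rewrite le_eqVlt; apply/orP; left; apply/eqP; ring.
- apply: (@le_lt_trans _ _ (3 * A0 ^+ 3 * (y ^+ 15 * z ^+ 36))).
    have -> : 3 * A0 ^+ 3 * (y ^+ 15 * z ^+ 36) = 3 * (A0 * y ^+ 5 * z ^+ 12) ^+ 3 by ring.
    by rewrite ler_wpM2l.
  apply: (@lt_le_trans _ _ (z ^+ 2 * (y ^+ 15 * z ^+ 36))).
    by rewrite ltr_pM2r// mulr_gt0.
  have -> : (z ^+ 20) ^+ 2 = z ^+ 2 * (z ^+ 2 * z ^+ 36) by ring.
  have h : y ^+ 15 * z ^+ 36 <= z ^+ 2 * z ^+ 36 by rewrite ler_wpM2r// ltW.
  by rewrite ler_wpM2l// ltW.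
- have h : P ^+ 5 / (z ^+ 20) ^+ 3 <= A0 ^+ 5 * y ^+ 25.
    rewrite ler_pdivrMr ?exprn_gt0//; apply: (le_trans (PQ 5%N)).
    by rewrite le_eqVlt; apply/orP; left; apply/eqP; ring.
  have h1 : 1 <= A0 ^+ 5 * y ^+ 25 by rewrite mulr_ege1// exprn_ege1.
  by rewrite -mulrA; move: (A0 ^+ 5 * y ^+ 25) (P ^+ 5 / _) h h1; clear; move=> a b; lra.
Qed.

Lemma log_factors (R : realType) (del : R) : 0 < del ->
  exists2 D : R, 1 <= D & forall N, (0 < N)%N ->
    harm R (6 * N ^ 3).+3 <= D * N%:R `^ del /\
    forall q, (0 < q <= N)%N -> (size (divisors q))%:R <= D * N%:R `^ del.
Proof.
move=> del0; have [C C1 hC] := size_divisors_le_powR del0.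
(* A third of [del], because the index of the harmonic number is of order N^3. *)
pose eta := del / 3; have eta0 : 0 < eta by rewrite divr_gt0.
pose D1 := (1 + eta^-1) * 9%:R `^ eta : R.
have D10 : 0 <= D1 by rewrite mulr_ge0 ?powR_ge0// addr_ge0// invr_ge0 ltW.
exists (D1 + C) => [|N N0]; first by rewrite (le_trans C1)// lerDr.
have C0 : 0 <= C by exact: le_trans C1.
have p0 : 0 <= N%:R `^ del by exact: powR_ge0.
split.
  apply: (le_trans (harm_le_powR eta0 (ltn0Sn _))).
  apply: (@le_trans _ _ (D1 * N%:R `^ del)); last by rewrite ler_wpM2r// lerDl.
  rewrite /D1 -mulrA ler_wpM2l//; first by rewrite addr_ge0// invr_ge0 ltW.
  have N9 : ((6 * N ^ 3).+3 <= 9 * N ^ 3)%N.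
    have : (0 < N ^ 3)%N by rewrite expn_gt0 N0.
    by lia.
  apply: (@le_trans _ _ ((9 * N ^ 3)%N%:R `^ eta)).
    by apply: ge0_ler_powR; rewrite ?nnegrE ?(ltW eta0) ?ler_nat.
  rewrite natrM powRM// natrX -(powR_mulrn 3 (ler0n R N)) -powRrM.
  by rewrite (_ : 3 * eta = del) // /eta mulrC divfK.
move=> q /andP[q0 qN]; apply: (le_trans (hC q q0)).
apply: (@le_trans _ _ (C * N%:R `^ del)).
  by rewrite ler_wpM2l//; apply: ge0_ler_powR; rewrite ?nnegrE ?(ltW del0) ?ler_nat.
by rewrite ler_wpM2r// lerDr.
Qed.

(** The 31 counts powers of y = N^del: 25 from P^5, one from [ell] in the constant of the triangle
    inequality and 5 from the vertex count. The condition with 150 is y^15 <= N^(1/10). The first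
    summand of the constant is for large N, the second for the bounded range of N where
    [level_bounds] fails. *)
Lemma measure_level_set_le (R : realType) (N : nat) (A : {fset nat})
    (theta lam c D eps del : R) :
  (0 < N)%N -> (forall n, n \in A -> (1 <= n <= N)%N) ->
  1 <= c -> 1 <= D -> 0 < lam -> 0 < del -> 31 * del <= eps -> 150 * del <= 1 ->
  harm R (6 * N ^ 3).+3 <= D * N%:R `^ del ->
  (forall q, (0 < q <= N)%N -> (size (divisors q))%:R <= D * N%:R `^ del) ->
  N%:R `^ (4^-1 + 10^-1) <= c * N%:R `^ del * lam ->
  (lebesgue_measure (level_set N A theta lam) <=
   ((16 * (12 * (80 * D * (16 * (4 * (320 * 16 * D * c ^+ 4) ^+ 5))) * (648 * D ^+ 5)) +
     16 * (3 * (320 * 16 * D * c ^+ 4) ^+ 3) ^+ 10) * N%:R `^ eps * (N%:R / lam ^+ 4))%:E)%E.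
Proof.
move=> N0 AN c1 D1 l0 del0 deps d150 lharm ldiv hlam.
have D0 : 0 < D by apply: lt_le_trans D1.
have c40 : 0 < c ^+ 4 by rewrite exprn_gt0// (lt_le_trans ltr01).
have [A0 AE] : exists A0, A0 = 320 * 16 * D * c ^+ 4 by exists (320 * 16 * D * c ^+ 4).
rewrite -AE.
have A00 : 0 < A0.
  by rewrite AE; exact: (mulr_gt0 (mulr_gt0 (mulr_gt0 (ltr0Sn R 319) (ltr0Sn R 15)) D0) c40).
have [Q1 QE] : exists Q1, Q1 = 12 * (80 * D * (16 * (4 * A0 ^+ 5))) * (648 * D ^+ 5).
  by exists (12 * (80 * D * (16 * (4 * A0 ^+ 5))) * (648 * D ^+ 5)).
rewrite -QE.
have Q10 : 0 <= Q1.
  rewrite QE; have D5 := exprn_ge0 5 (ltW D0); have A5 := exprn_ge0 5 (ltW A00).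
  exact: (mulr_ge0 (mulr_ge0 (ler0n R 12) (mulr_ge0 (mulr_ge0 (ler0n R 80) (ltW D0))
    (mulr_ge0 (ler0n R 16) (mulr_ge0 (ler0n R 4) A5)))) (mulr_ge0 (ler0n R 648) D5)).
have Q20 : 0 <= 16 * (3 * A0 ^+ 3) ^+ 10.
  apply: (mulr_ge0 (ler0n R 16)); apply: exprn_ge0.
  by apply: (mulr_ge0 (ler0n R 3)); apply: exprn_ge0; exact: ltW.
have Q16 : 0 <= 16 * Q1 by exact: mulr_ge0 (ler0n R 16) Q10.
set n := N%:R : R; have n1 : 1 <= n by rewrite ler1n.
have n0 : 0 < n by apply: lt_le_trans n1.
pose z := n `^ 20^-1; pose y := n `^ del.
have z1 : 1 <= z by rewrite powR_ge1// invr_ge0.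
have y1 : 1 <= y by rewrite powR_ge1// ltW.
have zE k : z ^+ k = n `^ (20^-1 * k%:R) by rewrite -powR_mulrn ?powR_ge0// -powRrM.
have yE k : y ^+ k = n `^ (del * k%:R) by rewrite -powR_mulrn ?powR_ge0// -powRrM.
have z20 : z ^+ 20 = n by rewrite zE mulVf ?powRr1 ?(ltW n0)// pnatr_eq0.
have zl : z ^+ 7 <= c * y * lam.
  have e1 : 20^-1 * 7%:R = 4^-1 + 10^-1 :> R by field.
  by rewrite zE e1.
have yz : y ^+ 15 <= z ^+ 2.
  by rewrite yE zE ler_powR//; move: d150; clear; lra.
have y31 : y ^+ 31 <= n `^ eps.
  by rewrite yE ler_powR//; move: deps; clear; lra.
have [V [x [t [hx dual hV]]]] := level_set_points theta N0 l0 AN.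
apply: (le_trans hV); rewrite lee_fin.
have [V0|Vpos] := posnP #|V|.
  rewrite V0 mul0r; apply: mulr_ge0; last by rewrite divr_ge0// exprn_ge0// ltW.
  apply: mulr_ge0; last exact: powR_ge0.
  exact: addr_ge0.
have VR : 0 < #|V|%:R :> R by rewrite ltr0n.
have l4 : 0 < lam ^+ 4 by rewrite exprn_gt0.
have M0 : 0 < lam ^+ 2 / 4 by rewrite divr_gt0// exprn_gt0.
have VN : #|V|%:R <= n by rewrite ler_nat -[leqRHS]card_ord max_card.
(* Duality tested on the indicator of a single point: the kernel at the origin is N, so lambda^2 / 4
   <= N. *)
have lN : lam ^+ 4 <= 16 * n ^+ 2.
  have /card_gt0P[k kV] := Vpos.
  have := dual (fun j => (j == k)%:R) (fun j => ler0n R _).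
  have one (g : 'I_N -> R) : \sum_(j in V) (j == k)%:R * g j = g k.
    rewrite (bigD1 k)//= eqxx mul1r big1 ?addr0// => j /andP[_ /negbTE ->].
    by rewrite mul0r.
  have -> : \sum_(j in V) (j == k)%:R = 1 :> R.
    by rewrite -[RHS](one (fun _ => 1)); apply: eq_bigr => j _; rewrite mulr1.
  under eq_bigr => r _ do under eq_bigr => s _ do rewrite -mulrA.
  under eq_bigr => r _ do rewrite -mulr_sumr one.
  rewrite one !subrr weyl_kernel00 expr1n mulr1 => h.
  have h2 : (lam ^+ 2 / 4) ^+ 2 <= n ^+ 2 by rewrite lerXn2r ?nnegrE ?(ltW M0) ?(ltW n0).
  have -> : lam ^+ 4 = 16 * (lam ^+ 2 / 4) ^+ 2 by field.
  by rewrite ler_pM2l.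
have ne1 : 1 <= n `^ eps.
  by rewrite powR_ge1//; move: del0 deps; clear; lra.
have nl : 0 < n / lam ^+ 4 by rewrite divr_gt0.
(* If z^2 = N^(1/10) is below the constant, N itself is bounded, and at most N cells together with
   [lN] give the claim. *)
have [G|G] := ltP (3 * A0 ^+ 3) (z ^+ 2); last first.
  have nA : n <= (3 * A0 ^+ 3) ^+ 10.
    have -> : n = (z ^+ 2) ^+ 10 by rewrite -exprM z20.
    by rewrite lerXn2r ?nnegrE ?exprn_ge0 ?(le_trans ler01 z1)// mulr_ge0// exprn_ge0// ltW.
  apply: (@le_trans _ _ (16 * (3 * A0 ^+ 3) ^+ 10 * n `^ eps * (n / lam ^+ 4))).
    apply: (@le_trans _ _ 1); first by rewrite ler_pdivrMr// mul1r.
    apply: (@le_trans _ _ (16 * n * 1 * (n / lam ^+ 4))).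
      have -> : 16 * n * 1 * (n / lam ^+ 4) = 16 * n ^+ 2 / lam ^+ 4 by ring.
      by rewrite ler_pdivlMr// mul1r.
    rewrite ler_pM2r//; apply: ler_pM => //; last by rewrite ler_wpM2l.
    by rewrite mulr_ge0// ltW.
  by rewrite ler_pM2r// ler_pM2r ?(lt_le_trans ltr01 ne1)// lerDr.
pose P := 320 * (D * y) * (z ^+ 20) ^+ 2 / (lam ^+ 2 / 4) ^+ 2.
have [g1 g2 g3] := level_bounds z1 y1 D1 c1 l0 zl yz (eq_ind A0 (fun a => 3 * a ^+ 3 < z ^+ 2) G _ AE) (erefl P).
rewrite z20 in g1 g2 g3.
have eb := @energy_bound R N V x t (lam ^+ 2 / 4) (D * y) P N0 M0 (mulr_ege1 D1 y1) lharm ldiv g1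
  (congr1 (fun a => 320 * (D * y) * a ^+ 2 / (lam ^+ 2 / 4) ^+ 2) z20) g2 hx dual.
rewrite -/n -AE in eb g3.
have y0 : 0 < y by apply: lt_le_trans y1.
have e2 : #|V|%:R * (lam ^+ 2 / 4) ^+ 2 <= Q1 * y ^+ 31 * n ^+ 2.
  apply: (le_trans eb).
  apply: (@le_trans _ _ (12 * (80 * (D * y) * n ^+ 2 * (16 * (4 * A0 ^+ 5 * y ^+ 25))) * (648 * (D * y) ^+ 5))).
    have Dy0 : 0 <= D * y by rewrite mulr_ge0// ltW.
    apply: (ler_wpM2r (mulr_ge0 (ler0n R 648) (exprn_ge0 5 Dy0))).
    apply: (ler_wpM2l (ler0n R 12)).
    apply: (ler_wpM2l (mulr_ge0 (mulr_ge0 (ler0n R 80) Dy0) (exprn_ge0 2 (ltW n0)))).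
    exact: (ler_wpM2l (ler0n R 16)).
  by rewrite QE le_eqVlt; apply/orP; left; apply/eqP; ring.
apply: (@le_trans _ _ (16 * Q1 * n `^ eps * (n / lam ^+ 4))).
  rewrite ler_pdivrMr//.
  have -> : 16 * Q1 * n `^ eps * (n / lam ^+ 4) * n = 16 * (Q1 * n `^ eps * n ^+ 2) / lam ^+ 4.
    by field; rewrite gt_eqF.
  rewrite ler_pdivlMr//.
  have -> : #|V|%:R * lam ^+ 4 = 16 * (#|V|%:R * (lam ^+ 2 / 4) ^+ 2) by field.
  rewrite ler_wpM2l//; apply: (le_trans e2).
  by rewrite ler_wpM2r ?exprn_ge0 ?(ltW n0)// ler_wpM2l.
by rewrite ler_pM2r// ler_pM2r ?(lt_le_trans ltr01 ne1)// lerDl.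
Qed.

Local Close Scope complex_scope.

Theorem corollary1p4 (R : realType) (CS Clambda : R -> R) :
  exists C : R -> R,
  forall (S : nat -> {fset nat}) (theta : R) (lambda : nat -> R),
    (forall N n : nat, (0 < N)%N -> n \in S N -> (1 <= n <= N)%N) ->
    lessapprox CS (fun N => (N%:R : R)%:E) (fun N => (#|` S N |%:R : R)%:E) ->
    0 <= theta <= 1 ->
    lessapprox Clambda (fun N => ((N%:R : R) `^ (4^-1 + 10^-1))%:E)
      (fun N => (lambda N)%:E) ->
    lessapprox C
      (fun N => lebesgue_measure (level_set N (S N) theta (lambda N)))
      (fun N => (N%:R / lambda N ^+ 4)%:E).
Proof.
(* The constant is chosen for each eps before S, theta and lambda are introduced, as the uniformity
   of the claim requires. *)
have /choice[C hC] : forall eps : R, exists Ceps : R, 0 < eps ->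
  forall (S : nat -> {fset nat}) (theta : R) (lambda : nat -> R),
    (forall N n : nat, (0 < N)%N -> n \in S N -> (1 <= n <= N)%N) ->
    lessapprox Clambda (fun N => ((N%:R : R) `^ (4^-1 + 10^-1))%:E)
      (fun N => (lambda N)%:E) ->
    0 < Ceps /\ forall N : nat, (0 < N)%N ->
    (lebesgue_measure (level_set N (S N) theta (lambda N)) <=
      (Ceps * N%:R `^ eps)%:E * (N%:R / lambda N ^+ 4)%:E)%E.
  move=> eps; have [eps0|] := boolP (0 < eps); last by exists 0.
  pose del := Num.min (eps / 31) 150^-1.
  have del0 : 0 < del.
    by rewrite /del lt_min divr_gt0//= invr_gt0.
  have deps : 31 * del <= eps.
    by rewrite mulrC -ler_pdivlMr// /del ge_min lexx.
  have d150 : 150 * del <= 1.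
    by rewrite mulrC -ler_pdivlMr// div1r /del ge_min lexx orbT.
  have [D D1 hD] := log_factors del0.
  (* The positivity of [Clambda del] is known only once lambda is given, after the constant has been
     fixed; hence the absolute value. Adding 1 secures c >= 1. *)
  pose c := 1 + `|Clambda del|.
  have c1 : 1 <= c by rewrite lerDl.
  pose K := 16 * (12 * (80 * D * (16 * (4 * (320 * 16 * D * c ^+ 4) ^+ 5))) * (648 * D ^+ 5)) +
     16 * (3 * (320 * 16 * D * c ^+ 4) ^+ 3) ^+ 10.
  exists (1 + `|K|) => _ S theta lambda hS hlam; split; first by rewrite ltr_pwDl.
  move=> N N0; have [cl0 /(_ N N0)] := hlam del del0.
  rewrite -EFinM lee_fin => hl.
  have n0 : 0 < N%:R :> R by rewrite ltr0n.
  have p0 : 0 < Clambda del * N%:R `^ del by rewrite mulr_gt0// powR_gt0.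
  have l0 : 0 < lambda N.
    by rewrite -(pmulr_rgt0 _ p0); apply: lt_le_trans hl; rewrite powR_gt0.
  have hl' : N%:R `^ (4^-1 + 10^-1) <= c * N%:R `^ del * lambda N.
    apply: (le_trans hl); rewrite ler_pM2r// ler_pM2r ?powR_gt0// /c.
    by rewrite (le_trans (ler_norm _))// lerDr.
  have [h1 h2] := hD N N0.
  apply: (le_trans (@measure_level_set_le R N (S N) theta (lambda N) c D eps del N0
    (fun n => hS N n N0) c1 D1 l0 del0 deps d150 h1 h2 hl')).
  rewrite -EFinM lee_fin -/K; apply: ler_wpM2r; first by rewrite divr_ge0// exprn_ge0// ltW.
  by apply: ler_wpM2r; [exact: powR_ge0 | rewrite (le_trans (ler_norm K))// lerDr].
exists C => S theta lambda hS _ _ hlam eps eps0.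
exact: hC eps eps0 S theta lambda hS hlam.
Qed.
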